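(* Let $m\geq 1$. There is a constant $C_m>0$ depending on $m$ such that the following holds. Let $\mathsf M\subset\mathbb{R}^D$ be a compact $C^2$ submanifold of dimension $m$ satisfying (P1), (P2), (P3) and (P4). There exist positive constants $C_1,\dots,C_5,\varepsilon_0$ having the subset stability property for $\mathsf M$ (defined in the context), and $\varepsilon_1>0$, such that: if $\mathsf A$ is a $(\delta,\varepsilon)$-sampling of $\mathsf M$ for some $0<\delta\leq\varepsilon\leq\varepsilon_1$, and if $z\in Z(\mathsf M)$ and $s$ is the cardinality of the set of projections $\pi_{\mathsf M}(z)$, then the number of critical points in $Z(\mathsf A)$ at distance less than $C_4\varepsilon$ from $z$ is bounded by $$2^{N(\delta,C_5\varepsilon)\,s}.$$ Furthermore, $$N(\delta,C_5\varepsilon)\leq (C_mC_5\varepsilon/\delta)^m.$$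
   Context: Standing assumption: $D\geq 2$. $d_H$ is the Hausdorff distance; $d_X(z)$ denotes the distance from $z$ to the set $X$; $B(x,r)$ is the open ball. Distance function. For a nonempty compact set $\mathsf{S}\subset\mathbb{R}^D$, let $d_{\mathsf S}(x)=\min_{y\in \mathsf S}\|x-y\|$ and $\pi_{\mathsf S}(x)=\{y\in\mathsf S: \|x-y\|=d_{\mathsf S}(x)\}$. For a nonempty bounded set $\sigma$, $m(\sigma)$ is the center of its smallest enclosing ball. The generalized gradient is $\nabla d_{\mathsf S}(x)=\frac{x-m(\pi_{\mathsf S}(x))}{d_{\mathsf S}(x)}$ for $x\notin\mathsf S$ and $0$ for $x\in\mathsf S$. The set of critical points is $Z(\mathsf S)=\{z\in\mathbb{R}^D\setminus\mathsf S:\nabla d_{\mathsf S}(z)=0\}$, and for $\mu\in[0,1]$ the set of $\mu$-critical points is $Z_\mu(\mathsf S)=\{z\in\mathbb{R}^D\setminus \mathsf S:\|\nabla d_{\mathsf S}(z)\|\leq\mu\}$. Conditions on a compact submanifold $\mathsf M\subset\mathbb{R}^D$: (P1) For every $z_0\in Z(\mathsf M)$, the projections $\pi_{\mathsf M}(z_0)$ are the vertices of a non-degenerate simplex (i.e. form a finite affinely independent set), and $z_0$ belongs to the relative interior of the convex hull of $\pi_{\mathsf M}(z_0)$. (P2) $Z(\mathsf M)$ is finite. (P3) For every $z_0\in Z(\mathsf M)$ and every $x_0\in\pi_{\mathsf M}(z_0)$, there exist $\delta>0$ and $\alpha>0$ such that for all $y\in\mathsf M\cap B(x_0,\delta)$,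 $\|y-z_0\|^2\geq\|x_0-z_0\|^2+\alpha\|y-x_0\|^2$. (P4) There exist $C>0$ and $\mu_0\in(0,1)$ such that for every $\mu\in[0,\mu_0)$, every point of $Z_\mu(\mathsf M)$ is at distance at most $C\mu$ from $Z(\mathsf M)$. Samplings. A finite subset $\mathsf A\subset\mathsf M$ is a $(\delta,\varepsilon)$-sampling of $\mathsf M$ if $d_H(\mathsf A,\mathsf M)\leq\varepsilon$ and $\min_{x\neq y\in\mathsf A}\|x-y\|\geq\delta$. For $\delta,\varepsilon>0$, the packing number $N(\delta,\varepsilon)$ of $\mathsf M$ is the maximal cardinality of a $(\delta,+\infty)$-sampling of a set $B(x,\varepsilon)\cap\mathsf M$ with $x\in\mathsf M$, i.e. of a finite subset of such a set whose points are pairwise at distance at least $\delta$. Subset stability property. Constants $C_1,\dots,C_5,\varepsilon_0>0$ have this property for $\mathsf M$ (satisfying (P1)-(P4)) if for every compact $\mathsf A\subset\mathsf M$ with $d_H(\mathsf A,\mathsf M)\leq\varepsilon\leq\varepsilon_0$: every $z\in Z(\mathsf A)$ satisfies exactly one of (a) $d_{\mathsf M}(z)\leq C_1\varepsilon^2$ or (b) $d_{Z_\mu(\mathsf M)}(z)\leq C_2\varepsilon$ for $\mu=C_3\varepsilon$; and in case (b), $d_{Z(\mathsf M)}(z)\leq C_4\varepsilon$ and $\pi_{\mathsf A}(z)$ is included in a neighborhood of size $C_5\varepsilon$ of $\pi_{\mathsf M}(z')$ for some $z'\in Z(\mathsf M)$ with $d(z,z')\leq C_4\varepsilon$. *)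

(* Defs.v *)
From HB Require Import structures.
From mathcomp Require Import all_boot all_order all_algebra.
From mathcomp Require Import all_classical all_reals all_analysis.

Set Implicit Arguments.
Unset Strict Implicit.
Unset Printing Implicit Defensive.

Import Order.TTheory GRing.Theory Num.Theory.
Import numFieldNormedType.Exports.

Local Open Scope classical_set_scope.
Local Open Scope card_scope.
Local Open Scope ring_scope.

(* The library norm on row vectors is the sup norm; it is used only through the
   topology and the derivatives it induces. All metric notions below are
   Euclidean. *)
Definition enorm (R : realType) (D : nat) (x : 'rV[R]_D) : R :=
  Num.sqrt (\sum_(i < D) x 0 i ^+ 2).

Definition eball (R : realType) (D : nat) (x : 'rV[R]_D) (r : R) :
  set 'rV[R]_D := [set y | enorm (x - y) < r].

Definition ecball (R : realType) (D : nat) (x : 'rV[R]_D) (r : R) :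
  set 'rV[R]_D := [set y | enorm (x - y) <= r].

(* Extended-real valued: the distance to the empty set is +oo. *)
Definition set_dist (R : realType) (D : nat) (S : set 'rV[R]_D)
  (x : 'rV[R]_D) : \bar R := ereal_inf [set (enorm (x - y))%:E | y in S].

Definition hausdorff_dist (R : realType) (D : nat) (A B : set 'rV[R]_D) :
    \bar R :=
  maxe (ereal_sup [set set_dist B a | a in A])
       (ereal_sup [set set_dist A b | b in B]).

Definition proj_set (R : realType) (D : nat) (S : set 'rV[R]_D)
  (x : 'rV[R]_D) : set 'rV[R]_D :=
  [set y | S y /\ (enorm (x - y))%:E = set_dist S x].

Definition smallest_enclosing_ball (R : realType) (D : nat)
    (sigma : set 'rV[R]_D) (c : 'rV[R]_D) (r : R) : Prop :=
  sigma `<=` ecball c r /\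
  forall c' r', sigma `<=` ecball c' r' -> r <= r'.

(* For nonempty bounded sigma the smallest enclosing ball exists and is unique,
   so the default value 0 and the choice made by xget are immaterial. *)
Definition seb_center (R : realType) (D : nat) (sigma : set 'rV[R]_D) :
    'rV[R]_D :=
  xget 0 [set c | exists r, smallest_enclosing_ball sigma c r].

Definition gen_grad (R : realType) (D : nat) (S : set 'rV[R]_D)
    (x : 'rV[R]_D) : 'rV[R]_D :=
  if x \in S then 0
  else (fine (set_dist S x))^-1 *: (x - seb_center (proj_set S x)).

Definition crit (R : realType) (D : nat) (S : set 'rV[R]_D) :
  set 'rV[R]_D := [set z | ~ S z /\ gen_grad S z = 0].

Definition mu_crit (R : realType) (D : nat) (mu : R) (S : set 'rV[R]_D) :
  set 'rV[R]_D := [set z | ~ S z /\ enorm (gen_grad S z) <= mu].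

Fixpoint is_Ck (R : realType) (n p k : nat) (U : set 'rV[R]_n)
    (f : 'rV[R]_n -> 'rV[R]_p) : Prop :=
  match k with
  | 0 => forall x, U x -> {for x, continuous f}
  | k'.+1 => (forall x, U x -> differentiable f x) /\
             (forall v, is_Ck k' U ('D_v f))
  end.

(* Embedded, without boundary: near each of its points, M is mapped by a C^2
   diffeomorphism phi : U -> W (with inverse psi) between open subsets of R^D
   to the part of W where the coordinates of index >= m vanish. *)
Definition C2_submanifold (R : realType) (m D : nat) (M : set 'rV[R]_D) :
    Prop :=
  (m <= D)%N /\
  forall x, M x ->
    exists (U W : set 'rV[R]_D) (phi psi : 'rV[R]_D -> 'rV[R]_D),
      [/\ open U /\ U x, open W,
          is_Ck 2 U phi /\ is_Ck 2 W psi,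
          (forall y, U y -> W (phi y) /\ psi (phi y) = y) /\
          (forall w, W w -> U (psi w) /\ phi (psi w) = w)
        & forall y, U y ->
            (M y <-> forall i : 'I_D, (m <= i)%N -> phi y 0 i = 0)].

Definition affine_set (R : realType) (D : nat) (A : set 'rV[R]_D) : Prop :=
  forall x y (t : R), A x -> A y -> A (t *: x + (1 - t) *: y).

Definition affine_hull (R : realType) (D : nat) (X : set 'rV[R]_D) :
  set 'rV[R]_D := smallest (@affine_set R D) X.

Definition convex_hull (R : realType) (D : nat) (X : set 'rV[R]_D) :
  set 'rV[R]_D := smallest (fun C => @convex_set R 'rV[R]_D C) X.

Definition rel_interior (R : realType) (D : nat) (C : set 'rV[R]_D) :
    set 'rV[R]_D :=
  [set z | C z /\ exists2 r : R, 0 < r &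
                    eball z r `&` affine_hull C `<=` C].

(* p_0, ..., p_k are affinely independent iff the vectors p_i - p_0, 1 <= i <= k,
   are linearly independent; in particular p is then injective. *)
Definition simplex_vertices (R : realType) (D : nat) (X : set 'rV[R]_D) :
    Prop :=
  exists (k : nat) (p : 'I_k.+1 -> 'rV[R]_D),
    X = range p /\ free [seq p (lift ord0 i) - p ord0 | i <- enum 'I_k].

Definition condP1 (R : realType) (D : nat) (M : set 'rV[R]_D) : Prop :=
  forall z0, crit M z0 ->
    simplex_vertices (proj_set M z0) /\
    rel_interior (convex_hull (proj_set M z0)) z0.

Definition condP2 (R : realType) (D : nat) (M : set 'rV[R]_D) : Prop :=
  finite_set (crit M).

Definition condP3 (R : realType) (D : nat) (M : set 'rV[R]_D) : Prop :=
  forall z0 x0, crit M z0 -> proj_set M z0 x0 ->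
    exists delta alpha : R, [/\ 0 < delta, 0 < alpha &
      forall y, (M `&` eball x0 delta) y ->
        enorm (x0 - z0) ^+ 2 + alpha * enorm (y - x0) ^+ 2
          <= enorm (y - z0) ^+ 2].

Definition condP4 (R : realType) (D : nat) (M : set 'rV[R]_D) : Prop :=
  exists C mu0 : R, [/\ 0 < C, 0 < mu0 < 1 &
    forall mu, 0 <= mu < mu0 ->
      forall z, mu_crit mu M z -> (set_dist (crit M) z <= (C * mu)%:E)%E].

(* A is a (delta, eps)-sampling of S; eps may be +oo. *)
Definition sampling (R : realType) (D : nat) (delta : R) (eps : \bar R)
    (S A : set 'rV[R]_D) : Prop :=
  [/\ finite_set A, A `<=` S, (hausdorff_dist A S <= eps)%E &
      forall x y, A x -> A y -> x <> y -> delta <= enorm (x - y)].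

Definition packing_cards (R : realType) (D : nat) (M : set 'rV[R]_D)
    (delta eps : R) : set nat :=
  [set n | exists x A, [/\ M x, sampling delta +oo%E (eball x eps `&` M) A
                         & A #= `I_n]].

(* The maximum exists whenever M is nonempty and compact and delta > 0. *)
Definition packing_number (R : realType) (D : nat) (M : set 'rV[R]_D)
    (delta eps : R) : nat :=
  xget 0%N [set n | packing_cards M delta eps n /\
                    forall k, packing_cards M delta eps k -> (k <= n)%N].

(* C1, ..., C5 and eps0 are assumed positive where this is used. *)
Definition subset_stability (R : realType) (D : nat) (M : set 'rV[R]_D)
    (C1 C2 C3 C4 C5 eps0 : R) : Prop :=
  forall (A : set 'rV[R]_D) (eps : R),
    compact A -> A `<=` M -> (hausdorff_dist A M <= eps%:E)%E -> eps <= eps0 ->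
    forall z, crit A z ->
      let a := (set_dist M z <= (C1 * eps ^+ 2)%:E)%E in
      let b := (set_dist (mu_crit (C3 * eps) M) z <= (C2 * eps)%:E)%E in
      [/\ a \/ b, ~ (a /\ b)
        & b -> (set_dist (crit M) z <= (C4 * eps)%:E)%E /\
               exists z', [/\ crit M z', enorm (z - z') <= C4 * eps
                 & forall y, proj_set A z y ->
                     (set_dist (proj_set M z') y <= (C5 * eps)%:E)%E]].

(* Main.v *)
(* Write d for the distance to M, R for the distance to A, and let z be critical
   for A, so that in every direction v some projection p of z on A satisfies
   <p - z, v> >= 0.  A C^2 chart gives |<b - x, z - x>| <= K |z - x| |b - x|^2
   whenever x is a projection of z on M and b lies in M; hence
   R(z)^2 <= d(z)^2 + B eps^2.  If d(z) is small, the same estimate at a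
   projection of z on A forces d(z) <= C1 eps^2.  Otherwise, as
   R(y)^2 <= R(z)^2 + |y - z|^2 for all y, the maximum over the ball of radius
   eps around z of y |-> d(y) - mu |y - z| with mu = C3 eps is attained in the
   interior, and there the generalized gradient has norm at most mu.  By (P4) z
   is then within C4 eps of a critical point z' of M, and the quadratic growth
   (P3) of |. - z'|^2 on M around the projections of z' locates those of z.

   A critical point of A is the center of the smallest enclosing ball of its
   projections, so it is determined by a subset of A; near z' these subsets lie
   in s balls containing at most N points each.  The bound on N compares M with
   an approximate tangent space and counts cubes in dimension m. *)
Require Import Defs.
From HB Require Import structures.
From mathcomp Require Import all_boot all_order all_algebra.
From mathcomp Require Import all_classical all_reals all_analysis.
From mathcomp Require Import ring lra.
Import Order.TTheory GRing.Theory Num.Theory.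
Import numFieldNormedType.Exports.
Local Open Scope classical_set_scope.
Local Open Scope card_scope.
Local Open Scope ring_scope.

Set Implicit Arguments.
Unset Strict Implicit.
Unset Printing Implicit Defensive.

Definition dot (R : realType) (D : nat) (u v : 'rV[R]_D) : R :=
  \sum_(i < D) u 0 i * v 0 i.

(** * Euclidean inner product and norm *)

Section Euclidean.
Context {R : realType} {D : nat}.
Implicit Types (x y z u v w : 'rV[R]_D) (a b c r t : R).

Lemma dotC u v : dot u v = dot v u.
Proof. by apply: eq_bigr => i _; rewrite mulrC. Qed.

Lemma dotDl u v w : dot (u + v) w = dot u w + dot v w.
Proof. by rewrite -big_split; apply: eq_bigr => i _; rewrite !mxE mulrDl. Qed.

Lemma dotDr u v w : dot w (u + v) = dot w u + dot w v.
Proof. by rewrite dotC dotDl ![dot _ w]dotC. Qed.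

Lemma dotZl a u v : dot (a *: u) v = a * dot u v.
Proof. by rewrite mulr_sumr; apply: eq_bigr => i _; rewrite !mxE mulrA. Qed.

Lemma dotZr a u v : dot u (a *: v) = a * dot u v.
Proof. by rewrite dotC dotZl dotC. Qed.

Lemma dotNl u v : dot (- u) v = - dot u v.
Proof. by rewrite -scaleN1r dotZl mulN1r. Qed.

Lemma dotNr u v : dot u (- v) = - dot u v.
Proof. by rewrite dotC dotNl dotC. Qed.

Lemma dotBl u v w : dot (u - v) w = dot u w - dot v w.
Proof. by rewrite dotDl dotNl. Qed.

Lemma dotBr u v w : dot w (u - v) = dot w u - dot w v.
Proof. by rewrite dotDr dotNr. Qed.

Lemma dot0l v : dot 0 v = 0.
Proof. by rewrite -(scale0r 0) dotZl mul0r. Qed.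

Lemma dot0r v : dot v 0 = 0.
Proof. by rewrite dotC dot0l. Qed.

Definition dotE := (dotBl, dotBr, dotDl, dotDr, dotNl, dotNr, dotZl, dotZr).

Lemma dot_sqrD u v : dot (u + v) (u + v) = dot u u + 2 * dot u v + dot v v.
Proof. by rewrite dotDl !dotDr (dotC v u); ring. Qed.

Lemma dot_suml (I : Type) (s : seq I) (F : I -> 'rV[R]_D) v :
  dot (\sum_(i <- s) F i) v = \sum_(i <- s) dot (F i) v.
Proof.
elim: s => [|i s IH]; first by rewrite !big_nil dot0l.
by rewrite !big_cons dotDl IH.
Qed.

Lemma dot_ge0 u : 0 <= dot u u.
Proof. by apply: sumr_ge0 => i _; rewrite -expr2 sqr_ge0. Qed.

Lemma dot_eq0 u : dot u u = 0 -> u = 0.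
Proof.
move=> /eqP; rewrite psumr_eq0; last by move=> i _; rewrite -expr2 sqr_ge0.
move=> /allP h; apply/rowP => i; have := h i (mem_index_enum i).
by rewrite /= mulf_eq0 orbb mxE => /eqP.
Qed.

Lemma enorm_ge0 u : 0 <= enorm u. Proof. exact: sqrtr_ge0. Qed.

Lemma enormE u : enorm u = Num.sqrt (dot u u).
Proof. by congr Num.sqrt; apply: eq_bigr => i _; rewrite expr2. Qed.

Lemma enorm_sqr u : enorm u ^+ 2 = dot u u.
Proof. by rewrite enormE sqr_sqrtr ?dot_ge0. Qed.

Lemma enorm_le_sqr u v : (enorm u <= enorm v) = (dot u u <= dot v v).
Proof. by rewrite !enormE ler_sqrt ?dot_ge0. Qed.

Lemma enorm_ler_sqr u r : 0 <= r -> (enorm u <= r) = (dot u u <= r ^+ 2).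
Proof. by move=> r0; rewrite -enorm_sqr ler_sqr ?nnegrE ?enorm_ge0. Qed.

Lemma enorm_ger_sqr u r : 0 <= r -> (r <= enorm u) = (r ^+ 2 <= dot u u).
Proof. by move=> r0; rewrite -enorm_sqr ler_sqr ?nnegrE ?enorm_ge0. Qed.

Lemma enorm0 : enorm (0 : 'rV[R]_D) = 0.
Proof. by rewrite enormE dot0l sqrtr0. Qed.

Lemma enorm_eq0 u : enorm u = 0 -> u = 0.
Proof. by move=> h; apply: dot_eq0; rewrite -enorm_sqr h expr0n. Qed.

Lemma enormZ a u : enorm (a *: u) = `|a| * enorm u.
Proof.
by rewrite !enormE dotZl dotZr mulrA -expr2 sqrtrM ?sqr_ge0// sqrtr_sqr.
Qed.

Lemma enormN u : enorm (- u) = enorm u.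
Proof. by rewrite !enormE dotNl dotNr opprK. Qed.

Lemma enormC x y : enorm (x - y) = enorm (y - x).
Proof. by rewrite -enormN opprB. Qed.

Lemma cauchy_schwarz u v : `|dot u v| <= enorm u * enorm v.
Proof.
have uu := dot_ge0 u; have vv := dot_ge0 v.
have key : dot u v ^+ 2 <= dot u u * dot v v.
  (* The squared norm of this vector is [dot v v] times the difference of the two sides of [key]. *)
  have := dot_ge0 (dot v v *: u - dot u v *: v); rewrite !dotE (dotC v u) => h.
  have [v0|v0] := eqVneq (dot v v) 0.
    by rewrite (dot_eq0 v0) !dot0r expr0n mulr0.
  have vp : 0 < dot v v by rewrite lt_neqAle eq_sym v0.
  have : 0 <= dot v v * (dot u u * dot v v - dot u v ^+ 2).
    by apply: le_trans h _; rewrite le_eqVlt; apply/orP; left; apply/eqP; ring.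
  by rewrite pmulr_rge0// subr_ge0.
rewrite -ler_sqr ?nnegrE ?mulr_ge0 ?enorm_ge0 ?normr_ge0//.
by rewrite exprMn !enorm_sqr real_normK ?num_real.
Qed.

Lemma dot_le u v : dot u v <= enorm u * enorm v.
Proof. exact: le_trans (ler_norm _) (cauchy_schwarz u v). Qed.

Lemma ge_dot u v : - (enorm u * enorm v) <= dot u v.
Proof. by have := cauchy_schwarz u v; rewrite ler_norml => /andP[]. Qed.

Lemma enormD u v : enorm (u + v) <= enorm u + enorm v.
Proof.
rewrite enorm_ler_sqr ?addr_ge0 ?enorm_ge0// dot_sqrD sqrrD !enorm_sqr.
by rewrite lerD2r lerD2l -[leRHS]mulr_natl ler_wpM2l// dot_le.
Qed.

Lemma enorm_dist3 y x z : enorm (x - z) <= enorm (x - y) + enorm (y - z).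
Proof. by rewrite (_ : x - z = (x - y) + (y - z)) ?enormD// addrA subrK. Qed.

Lemma enorm_sum (I : Type) (s : seq I) (F : I -> 'rV[R]_D) :
  enorm (\sum_(i <- s) F i) <= \sum_(i <- s) enorm (F i).
Proof.
elim: s => [|i s IH]; first by rewrite !big_nil enorm0.
by rewrite !big_cons; apply: le_trans (enormD _ _) _; rewrite lerD2l.
Qed.

Lemma coord_le_enorm u i : `|u 0 i| <= enorm u.
Proof.
rewrite -sqrtr_sqr ler_sqrt ?sumr_ge0//; last by move=> j _; exact: sqr_ge0.
by rewrite (bigD1 i)//= lerDl sumr_ge0// => j _; exact: sqr_ge0.
Qed.

Lemma norm_le_enorm u : `|u| <= enorm u.
Proof.
rewrite /Num.norm/= mx_normrE; apply/bigmax_leP; split; first exact: enorm_ge0.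
by move=> [i j] _ /=; rewrite ord1; exact: coord_le_enorm.
Qed.

Lemma coord_le_norm u i : `|u 0 i| <= `|u|.
Proof.
rewrite {2}/Num.norm/= mx_normrE.
exact: (le_bigmax_cond 0 (fun ij : 'I_1 * 'I_D => `|u ij.1 ij.2|) (j := (0, i))).
Qed.

Lemma enorm_le_norm u : enorm u <= D%:R * `|u|.
Proof.
rewrite enorm_ler_sqr ?mulr_ge0//.
apply: (@le_trans _ _ (\sum_(i < D) `|u| ^+ 2)).
  apply: ler_sum => i _; rewrite -expr2 -(real_normK (num_real (u 0 i))).
  by rewrite ler_sqr ?nnegrE// coord_le_norm.
rewrite sumr_const card_ord -[_ *+ D]mulr_natl exprMn ler_wpM2r ?sqr_ge0//.
by rewrite -natrX ler_nat; case: (D) => // n; rewrite leq_pmulr.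
Qed.

Lemma eball_center x r : 0 < r -> eball x r x.
Proof. by rewrite /eball/= subrr enorm0. Qed.

Lemma nbhs_eball x r : 0 < r -> nbhs x (eball x r).
Proof.
(* [D.+1] in place of [D] keeps the denominator positive in dimension 0. *)
move=> r0; apply/nbhs_ballP; exists (r / D.+1%:R); first by rewrite /= divr_gt0.
move=> y; rewrite -ball_normE /= /eball /= => h.
apply: le_lt_trans (enorm_le_norm _) _.
apply: (@le_lt_trans _ _ (D.+1%:R * `|x - y|)).
  by rewrite ler_wpM2r// ler_nat.
by rewrite mulrC -ltr_pdivlMr.
Qed.

Lemma nbhs_eballP x (U : set 'rV[R]_D) :
  nbhs x U <-> exists2 r, 0 < r & eball x r `<=` U.
Proof.
split=> [/nbhs_ballP[r /= r0 h]|[r r0 h]]; last first.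
  have /nbhs_ballP[e e0 he] := nbhs_eball x r0.
  by apply/nbhs_ballP; exists e => // y /he /h.
exists r => // y hy; apply: h; rewrite -ball_normE /=.
exact: le_lt_trans (norm_le_enorm _) hy.
Qed.

Lemma lipschitz_continuous (f : 'rV[R]_D -> R) K :
  (forall x y, `|f x - f y| <= K * enorm (x - y)) -> continuous f.
Proof.
move=> fl x; apply/(@cvgrPdist_lt _ _ _ _ (nbhs_filter x)) => e e0.
pose k := Num.max K 0 + 1.
have k0 : 0 < k by rewrite /k ltr_wpDl// le_max lexx orbT.
apply/nbhs_eballP; exists (e / k); first exact: divr_gt0.
move=> y; rewrite /eball /= ltr_pdivlMr// => h.
apply: le_lt_trans (fl _ _) _; apply: le_lt_trans h.
rewrite mulrC ler_wpM2l ?enorm_ge0// /k.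
by apply: (@le_trans _ _ (Num.max K 0)); rewrite ?le_max ?lexx// lerDl.
Qed.

Lemma lipschitz1_continuous (f : 'rV[R]_D -> R) :
  (forall x y, f x <= enorm (x - y) + f y) -> continuous f.
Proof.
move=> fl; apply: (@lipschitz_continuous _ 1) => x y; rewrite mul1r ler_distl.
by rewrite lerBlDl [f y + _]addrC {1}enormC !fl.
Qed.

Lemma continuous_dist z : continuous (fun x => enorm (x - z)).
Proof.
by apply: lipschitz1_continuous => x y; exact: enorm_dist3.
Qed.

Lemma continuous_distr z : continuous (fun x => enorm (z - x)).
Proof.
by rewrite (_ : (fun _ => _) = (fun x => enorm (x - z)));
  [exact: continuous_dist | apply/funext => x; rewrite enormC].
Qed.

Lemma continuous_dotl v : continuous (fun x => dot x v).
Proof.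
apply: (@lipschitz_continuous _ (enorm v)) => x y.
by rewrite -dotBl mulrC cauchy_schwarz.
Qed.

Lemma closed_ecball x r : closed (ecball x r).
Proof.
rewrite (_ : ecball x r = (fun y => enorm (x - y)) @^-1` [set t | t <= r])//.
by apply: closed_comp; [move=> y _; exact: continuous_distr | exact: closed_le].
Qed.

Lemma compact_ecball x r : compact (ecball x r).
Proof.
apply: bounded_closed_compact.
  exists (enorm x + r); split; first exact: num_real.
  move=> M hM y /= hy; apply: le_trans (norm_le_enorm _) _.
  apply/ltW; apply: le_lt_trans hM.
  rewrite (_ : y = x - (x - y)); last by rewrite subKr.
  by apply: le_trans (enormD _ _) _; rewrite enormN lerD2l.
exact: closed_ecball.
Qed.

Lemma closed_dist_ge x r : closed [set y | r <= enorm (x - y)].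
Proof.
rewrite (_ : [set y | _] = (fun y => enorm (x - y)) @^-1` [set t | r <= t])//.
by apply: closed_comp; [move=> y _; exact: continuous_distr | exact: closed_ge].
Qed.

End Euclidean.

(** Real-valued form of [set_dist], and the denominator in [gen_grad]. For the empty set [fine]
    turns the infinite distance into 0, so the facts below assume nonempty sets or a given
    projection. *)
Definition dist (R : realType) (D : nat) (S : set 'rV[R]_D) (x : 'rV[R]_D) : R :=
  fine (set_dist S x).

(** * Projections and smallest enclosing balls *)

Section Distance.
Context {R : realType} {D : nat}.
Implicit Types (x y z p c u v : 'rV[R]_D) (S G A M : set 'rV[R]_D) (r d : R).

Lemma set_dist_le S x y : S y -> (set_dist S x <= (enorm (x - y))%:E)%E.
Proof. by move=> Sy; apply: ereal_inf_lbound; exists y. Qed.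

Lemma set_dist_ge S x (e : \bar R) :
  (forall y, S y -> (e <= (enorm (x - y))%:E)%E) -> (e <= set_dist S x)%E.
Proof. by move=> h; apply/ereal_infP => _ [y Sy <-]; exact: h. Qed.

Lemma proj_setP S x p :
  proj_set S x p <-> S p /\ forall y, S y -> enorm (x - p) <= enorm (x - y).
Proof.
split=> [[Sp e]|[Sp h]].
  by split=> // y Sy; rewrite -lee_fin e set_dist_le.
split=> //; apply/eqP; rewrite eq_le set_dist_le// andbT.
by apply: set_dist_ge => y Sy; rewrite lee_fin h.
Qed.

Lemma proj_set_dist S x p : proj_set S x p -> dist S x = enorm (x - p).
Proof. by case=> _ e; rewrite /dist -e. Qed.

Lemma continuous_within (T : topologicalType) (f : T -> R) (A : set T) :
  continuous f -> {within A, continuous f}.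
Proof. by move=> cf; apply: continuous_subspaceT. Qed.

Section Compact.
Context (S : set 'rV[R]_D) (S0 : S !=set0) (cS : compact S).

Lemma proj_set_neq0 x : proj_set S x !=set0.
Proof.
have [p Sp h] := EVT_min_rV S0 cS (continuous_within (@continuous_distr _ _ x)).
exists p; apply/proj_setP; split; first by move: Sp; rewrite inE.
by move=> y Sy; apply: h; rewrite inE.
Qed.

Lemma set_dist_fin x : set_dist S x = (dist S x)%:E.
Proof. by have [p pp] := proj_set_neq0 x; rewrite (proj_set_dist pp); case: pp. Qed.

Lemma dist_le x y : S y -> dist S x <= enorm (x - y).
Proof. by move=> Sy; rewrite -lee_fin -set_dist_fin set_dist_le. Qed.

Lemma dist_ge0 x : 0 <= dist S x.
Proof. by have [p /proj_set_dist->] := proj_set_neq0 x; exact: enorm_ge0. Qed.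

Lemma dist_gt0 x : ~ S x -> 0 < dist S x.
Proof.
have [p pp] := proj_set_neq0 x => nSx; rewrite lt_neqAle dist_ge0 andbT.
apply/eqP => e; apply: nSx; move: e; rewrite (proj_set_dist pp) => /esym/enorm_eq0.
by case: pp => Sp _ /eqP; rewrite subr_eq0 => /eqP ->.
Qed.

Lemma dist_gt0_notin x : 0 < dist S x -> ~ S x.
Proof. by move=> d0 /(dist_le x); rewrite subrr enorm0 leNgt d0. Qed.

Lemma dist_triangle x y : dist S x <= enorm (x - y) + dist S y.
Proof.
have [p pp] := proj_set_neq0 y; rewrite (proj_set_dist pp).
by apply: le_trans (enorm_dist3 y x p); apply: dist_le; case: pp.
Qed.

Lemma continuous_dist_set : continuous (dist S).
Proof.
by apply: lipschitz1_continuous => x y; exact: dist_triangle.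
Qed.

Lemma proj_set_compact x : compact (proj_set S x).
Proof.
have [p pp] := proj_set_neq0 x.
rewrite (_ : proj_set S x = S `&` ecball x (dist S x)).
  by apply: compact_closedI => //; exact: closed_ecball.
apply/seteqP; split => y.
  by move=> py; split; [case: py | rewrite /ecball/= (proj_set_dist py)].
move=> [Sy hy]; apply/proj_setP; split => // y' Sy'.
by apply: le_trans hy _; exact: dist_le.
Qed.

(** The points [F] of S at distance at least eta from all projections form a compact set. The
    minimum over [F] of the distance to x exceeds [dist S x], and theta is half of the gap. *)
Lemma near_proj_set x (eta : R) : 0 < eta ->
  exists2 theta, 0 < theta & forall p, S p -> enorm (x - p) <= dist S x + theta ->
    exists2 q, proj_set S x q & enorm (p - q) < eta.
Proof.
move=> eta0.
pose F := S `&` \bigcap_(q in proj_set S x) [set y | eta <= enorm (q - y)].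
have cF : compact F.
  apply: compact_closedI => //; apply: closed_bigI => q _; exact: closed_dist_ge.
have far p : S p -> ~ F p -> exists2 q, proj_set S x q & enorm (p - q) < eta.
  move=> Sp nFp; apply: contrapT => no; apply: nFp; split=> // q pq.
  by rewrite /= leNgt; apply/negP => lt; apply: no; exists q; rewrite // enormC.
have [F0|F0] := pselect (F !=set0); last first.
  by exists 1 => // p Sp _; apply: far => // Fp; apply: F0; exists p.
have [b Fb hb] := EVT_min_rV F0 cF (continuous_within (@continuous_distr _ _ x)).
have {Fb} [Sb fb] : F b by move: Fb; rewrite inE.
have lt : dist S x < enorm (x - b).
  rewrite ltNge; apply/negP => le; have /fb : proj_set S x b.
    by apply/proj_setP; split=> // y Sy; exact: le_trans le (dist_le _ Sy).
  by rewrite /= subrr enorm0 leNgt eta0.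
exists ((enorm (x - b) - dist S x) / 2); first by lra.
move=> p Sp hp; apply: far => // Fp.
have : enorm (x - b) <= enorm (x - p) by apply: hb; rewrite inE.
by lra.
Qed.

End Compact.

Lemma hausdorff_proj A M (eps : R) : M !=set0 -> compact A ->
    (hausdorff_dist A M <= eps%:E)%E ->
  A !=set0 /\ forall x, M x -> exists2 y, A y & enorm (x - y) <= eps.
Proof.
move=> [x0 Mx0] cA; rewrite /hausdorff_dist ge_max => /andP[_ h].
have {}h x : M x -> (set_dist A x <= eps%:E)%E.
  by move=> Mx; apply: le_trans h; apply: ereal_sup_ubound; exists x.
(* An empty A would be at infinite distance from [x0], against the real bound eps. *)
have A0 : A !=set0.
  apply: contrapT => no; have := h _ Mx0; rewrite leNgt => /negP; apply.
  apply: (@lt_le_trans _ _ +oo%E); first exact: ltry.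
  by apply: set_dist_ge => y Ay; case: no; exists y.
split=> // x /h; have [p pp] := proj_set_neq0 A0 cA x.
by case: pp => Ap <-; rewrite lee_fin; exists p.
Qed.

(** The radius [f c] needed around c is the distance to a farthest point [g c] of G, hence
    1-Lipschitz in c. It attains a minimum on the ball of radius [f p0] around a point [p0] of G;
    outside that ball [f c'] is at least the distance from [c'] to [p0], which exceeds [f p0]. *)
Lemma smallest_enclosing_ball_exists G : G !=set0 -> compact G ->
  exists c r, smallest_enclosing_ball G c r.
Proof.
move=> G0 cG; have [p0 Gp0] := G0.
have far c : exists2 p, G p & forall y, G y -> enorm (c - y) <= enorm (c - p).
  have [p Gp h] := EVT_max_rV G0 cG (continuous_within (@continuous_distr _ _ c)).
  by exists p => [|y Gy]; [move: Gp; rewrite inE | apply: h; rewrite inE].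
pose g c := xget 0 [set p | G p /\ forall y, G y -> enorm (c - y) <= enorm (c - p)].
have gP c : G (g c) /\ forall y, G y -> enorm (c - y) <= enorm (c - g c).
  by have [p Gp h] := far c; rewrite /g; case: xgetP => [_ _ //|/(_ p)[]].
pose f c := enorm (c - g c).
have f_lip x y : f x <= enorm (x - y) + f y.
  apply: le_trans (enorm_dist3 y _ _) _; rewrite lerD2l.
  by apply: (gP y).2; exact: (gP x).1.
have cf : continuous f by exact: lipschitz1_continuous f_lip.
have B0 : ecball p0 (f p0) !=set0.
  by exists p0; rewrite /ecball/= subrr enorm0 enorm_ge0.
have [c Bc hc] :=
  EVT_min_rV B0 (@compact_ecball _ _ p0 (f p0)) (continuous_within cf).
have {}hc c' : f c <= f c'.
  have [le|lt] := leP (enorm (p0 - c')) (f p0).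
    by apply: hc; rewrite inE.
  apply: (@le_trans _ _ (f p0)).
    by apply: hc; rewrite inE /ecball/= subrr enorm0 enorm_ge0.
  by apply: le_trans (ltW lt) _; rewrite enormC; exact: (gP c').2.
exists c, (f c); split=> [y Gy|c' r' h]; first exact: (gP c).2.
by apply: le_trans (hc c') _; apply: h; exact: (gP c').1.
Qed.

Lemma seb_centerP G : G !=set0 -> compact G ->
  exists r, smallest_enclosing_ball G (seb_center G) r.
Proof.
move=> G0 cG; have [c [r h]] := smallest_enclosing_ball_exists G0 cG.
rewrite /seb_center; case: xgetP => [c' _ //|/(_ c) no].
by case: no; exists r.
Qed.

(* Moving the center c towards y0 shows r ^ 2 <= d ^ 2 - |y0 - c| ^ 2. *)
Lemma seb_sphere_obtuse G y0 c r d : G !=set0 -> smallest_enclosing_ball G c r ->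
  (forall p, G p -> enorm (y0 - p) = d) ->
  forall p, G p -> dot (p - c) (y0 - c) <= 0.
Proof.
move=> [p0 Gp0] [Gr rmin] Gd p Gp.
have r0 : 0 <= r := le_trans (enorm_ge0 _) (Gr _ Gp0).
set u := y0 - c.
have sq q : G q -> dot (c - q) (c - q) <= r ^+ 2.
  by move=> /Gr; rewrite /ecball/= enorm_ler_sqr.
have dq q : G q -> dot (c - q) (c - q) + 2 * dot (c - q) u + dot u u = d ^+ 2.
  move=> /Gd <-; rewrite enorm_sqr (_ : y0 - q = (c - q) + u).
    by rewrite [RHS]dot_sqrD.
  by rewrite /u [RHS]addrC subrKA.
(* The right side bounds the squared distances from [c + s *: u] to the points of G, so minimality
   of r applies. Cancelling and dividing by s, then letting s tend to 0, gives [fin]. *)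
have step s : 0 < s < 1 ->
    r ^+ 2 <= (1 - s) * r ^+ 2 + s * (d ^+ 2 - (1 - s) * dot u u).
  move=> /andP[s0 s1].
  set b := (_ + _).
  have hb q : G q -> dot (c + s *: u - q) (c + s *: u - q) <= b.
    move=> Gq; rewrite (_ : c + s *: u - q = (c - q) + s *: u); last first.
      by rewrite addrAC.
    rewrite [leLHS](_ : _ = dot (c - q) (c - q) + 2 * s * dot (c - q) u
        + s ^+ 2 * dot u u); last first.
      by rewrite dot_sqrD dotZl !dotZr; ring.
    have -> : 2 * s * dot (c - q) u =
        s * (d ^+ 2 - dot (c - q) (c - q) - dot u u) by rewrite -(dq _ Gq); ring.
    have : (1 - s) * dot (c - q) (c - q) <= (1 - s) * r ^+ 2.
      by apply: ler_wpM2l; [lra | exact: sq].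
    by rewrite /b; lra.
  have b0 : 0 <= b by apply: le_trans (hb _ Gp0); exact: dot_ge0.
  have : r <= Num.sqrt b.
    apply: (rmin (c + s *: u)) => q Gq.
    by rewrite /ecball/= enormE ler_sqrt// hb.
  by rewrite -ler_sqr ?nnegrE ?sqrtr_ge0// sqr_sqrtr.
have lim s : 0 < s < 1 -> r ^+ 2 <= d ^+ 2 - dot u u + s * dot u u.
  move=> s01; have := step s s01; move: s01 => /andP[s0 s1] h.
  have : s * r ^+ 2 <= s * (d ^+ 2 - (1 - s) * dot u u) by lra.
  by rewrite ler_pM2l// => ?; lra.
have fin : r ^+ 2 <= d ^+ 2 - dot u u.
  apply/ler_addgt0Pr => e e0; have uu := dot_ge0 u.
  pose s := Num.min (1 / 2) (e / (dot u u + 1)).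
  have s0 : 0 < s.
    by rewrite lt_min; apply/andP; split; [lra | apply: divr_gt0 => //; lra].
  have s1 : s < 1.
    by apply: le_lt_trans (_ : 1 / 2 < 1); [rewrite ge_min lexx | lra].
  apply: le_trans (lim s _) _; first by rewrite s0.
  rewrite lerD2l; apply: (@le_trans _ _ (e / (dot u u + 1) * dot u u)).
    by rewrite ler_wpM2r// ge_min lexx orbT.
  rewrite mulrAC ler_pdivrMr ?ltr_wpDl//.
  by rewrite ler_wpM2l ?(ltW e0)// lerDl.
have := dq _ Gp; have := sq _ Gp.
by rewrite -[p - c]opprB dotNl; lra.
Qed.

Lemma crit_seb_center A z : A !=set0 -> compact A -> crit A z ->
  z = seb_center (proj_set A z).
Proof.
move=> A0 cA [nAz]; rewrite /gen_grad memNset// => /eqP.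
rewrite scaler_eq0 invr_eq0 gt_eqF; last exact: dist_gt0.
by rewrite subr_eq0 => /eqP.
Qed.

(** If [dot (p - z) v] were negative for every projection p, moving z a little against v would bring
    it strictly closer to all of them, although z is the center of their smallest enclosing ball. *)
Lemma crit_direction A z v : A !=set0 -> compact A -> crit A z ->
  exists2 p, proj_set A z p & 0 <= dot (p - z) v.
Proof.
move=> A0 cA Az; have d0 := dist_gt0 A0 cA Az.1.
have pn0 := proj_set_neq0 A0 cA z; have cp := proj_set_compact A0 cA (x := z).
have [r [Br rmin]] := seb_centerP pn0 cp.
rewrite -(crit_seb_center A0 cA Az) in Br rmin.
set d := dist A z in d0; have dE p : proj_set A z p -> dot (p - z) (p - z) = d ^+ 2.
  by move=> /proj_set_dist dE; rewrite -enorm_sqr enormC -dE.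
have [p0 pp0] := pn0.
have [p pp hp] := EVT_max_rV pn0 cp
  (continuous_within (@continuous_dotl _ _ v)).
have {}pp : proj_set A z p by move: pp; rewrite inE.
exists p => //; rewrite leNgt; apply/negP => lt.
set a := dot (p - z) v in lt.
have ha q : proj_set A z q -> dot (q - z) v <= a.
  by move=> pq; rewrite /a !dotBl lerD2r hp// inE.
have rd : d <= r.
  by rewrite /d (proj_set_dist pp); exact: Br.
have vv := dot_ge0 v.
(* With this t, t^2 |v|^2 is at most - t a, so the squared distances drop from d^2 to at most d^2 +
   t a. *)
pose t := - a / (dot v v + 1).
have t0 : 0 < t by rewrite divr_gt0//; lra.
have tv : t * (dot v v + 1) = - a by rewrite divfK// gt_eqF//; lra.
pose b := d ^+ 2 + t * a.
have hb q : proj_set A z q -> dot (z - t *: v - q) (z - t *: v - q) <= b.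
  move=> pq; rewrite (_ : z - t *: v - q = - ((q - z) + t *: v)); last first.
    by rewrite !opprD !opprK addrC addrA.
  rewrite dotNl dotNr opprK dot_sqrD dotZl !dotZr dE// /b.
  have := ha _ pq; rewrite -(ler_pM2l t0) => h1.
  have : t * (t * dot v v) = t * (- a - t) by rewrite -tv; ring.
  have := mulr_gt0 t0 t0; nra.
have b0 : 0 <= b by apply: le_trans (hb _ pp); exact: dot_ge0.
have : r <= Num.sqrt b.
  by apply: (rmin (z - t *: v)) => q pq; rewrite /ecball/= enormE ler_sqrt// hb.
apply/negP; rewrite -ltNge; apply: lt_le_trans rd.
by rewrite -ltr_sqr ?nnegrE ?sqrtr_ge0 ?(ltW d0)// sqr_sqrtr// /b; nra.
Qed.

End Distance.

(** * Uniform choices of small constants *)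

Section SmallScales.
Context {R : realType}.

(** Fixes in one go a scale meeting finitely many smallness conditions t a < b with b > 0, whatever
    the signs of the a. *)
Lemma exists_small_scale (s : seq (R * R)) : all (fun ab => 0 < ab.2) s ->
  exists2 t : R, 0 < t &
    forall t', 0 <= t' <= t -> all (fun ab => t' * ab.1 < ab.2) s.
Proof.
elim: s => [_|[a b] s IH /= /andP[b0 /IH[t t0 ht]]]; first by exists 1.
have k0 : 0 < `|a| + 1 by rewrite ltr_wpDl.
exists (Num.min t (b / (`|a| + 1))); first by rewrite lt_min t0 divr_gt0.
move=> t' /andP[t'0]; rewrite le_min ler_pdivlMr// => /andP[t't h].
rewrite ht ?t'0// andbT.
apply: (@le_lt_trans _ _ (t' * `|a|)); first by rewrite ler_wpM2l// ler_norm.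
have [->|/eqP t'n] := eqVneq t' 0; first by rewrite mul0r.
apply: lt_le_trans h; rewrite ltr_pM2l ?ltrDl// lt_neqAle t'0 eq_sym andbT.
exact/eqP.
Qed.

(** Compactness in near-covering form, along the filter of small positive r: since [P] passes to
    smaller r, each local radius yields a product neighbourhood on which [P] holds. *)
Lemma compact_uniform_radius D (S : set 'rV[R]_D) (P : R -> 'rV[R]_D -> Prop) :
    compact S -> (forall r r' x, 0 < r' <= r -> P r x -> P r' x) ->
    (forall x0, S x0 ->
       exists2 r, 0 < r & forall x, S x -> eball x0 r x -> P r x) ->
  exists2 r, 0 < r & forall x, S x -> P r x.
Proof.
move=> cS mono loc.
have ncS : near_covering S := (compact_near_coveringP S).1 cS.
have [|r [r0 hr]] := @filter_ex _ (0^'+ : set_system R) _ _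
    (filterI (nbhs_right_gt 0)
       (ncS R 0^'+ (fun r x => S x -> P r x) _ _)); last first.
  by exists r => // x Sx; exact: hr.
move=> x0 Sx0; have [r r0 h] := loc _ Sx0.
exists (eball x0 r, [set t : R | 0 < t <= r]) => /=.
  split; first exact: nbhs_eball.
  near=> t; apply/andP; split; first by near: t; exact: nbhs_right_gt.
  by near: t; exact: nbhs_right_le.
by move=> [x t] /= [hx ht] Sx; apply: mono ht _; exact: h.
Unshelve. all: by end_near. Qed.

End SmallScales.

(** * Generalized gradient at a penalized local maximum *)

Section LocalMax.
Context {R : realType} {D : nat}.
Implicit Types (x y z p c u v : 'rV[R]_D) (M : set 'rV[R]_D).

(** Let u be the numerator of the gradient. All projections q satisfy <y0 - q, u> >= |u|^2, so
    moving from y0 along u increases the distance to M at rate about |u| / d per unit length, while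
    [ymax] allows only mu. *)
Lemma gen_grad_local_max M y0 (mu r : R) : M !=set0 -> compact M -> ~ M y0 ->
    0 <= mu -> 0 < r ->
    (forall y, enorm (y - y0) < r ->
       dist M y <= dist M y0 + mu * enorm (y - y0)) ->
  enorm (gen_grad M y0) <= mu.
Proof.
move=> M0 cM nMy mu0 r0 ymax.
have d0 := dist_gt0 M0 cM nMy; set d := dist M y0 in d0 ymax *.
have G0 := proj_set_neq0 M0 cM y0; have cG := proj_set_compact M0 cM (x := y0).
have [r1 sebG] := seb_centerP G0 cG.
rewrite /gen_grad memNset// -/d.
set u := y0 - seb_center _.
have {sebG} obt q : proj_set M y0 q -> dot u u <= dot (y0 - q) u.
  move=> Gq; have := seb_sphere_obtuse (y0 := y0) (d := d) G0 sebG.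
  move=> /(_ (fun p pp => esym (proj_set_dist pp)) q Gq).
  rewrite -/u (_ : y0 - q = u - (q - seb_center (proj_set M y0))).
    by rewrite [dot (u - _) u]dotBl; lra.
  by rewrite /u opprB addrA subrK.
rewrite enormZ gtr0_norm ?invr_gt0// mulrC ler_pdivrMr//.
set n := enorm u; rewrite leNgt; apply/negP => lt.
have n0 : 0 < n by apply: le_lt_trans lt; rewrite mulr_ge0// ltW.
pose g := n * (n - mu * d).
have g0 : 0 < g by rewrite mulr_gt0// subr_gt0.
(* Replacing a projection of y0 by a point within this distance changes its inner product with u by
   at most g / 4. *)
have eta0 : 0 < (n - mu * d) / 4 by rewrite divr_gt0// subr_gt0.
have [theta theta0 near] := near_proj_set M0 cM y0 eta0.
have [|t t0 /(_ t)] := @exists_small_scale R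
  (* In order: the moved point stays where [ymax] applies, its projection is almost a projection of
     y0, and the term of order t^2 is absorbed by t g. *)
  [:: (n, r); (2 * n, theta); (mu ^+ 2 * n ^+ 2, g)].
  by rewrite /= r0 theta0 g0.
rewrite lexx ltW//= => /(_ isT) /and4P[tr ttheta tg _].
have yy : enorm (y0 + t *: u - y0) = t * n.
  by rewrite addrC addKr enormZ gtr0_norm.
have := ymax (y0 + t *: u); rewrite yy => /(_ tr) ymax1.
have [p pp] := proj_set_neq0 M0 cM (y0 + t *: u).
rewrite (proj_set_dist pp) in ymax1.
have [Mp _] := pp.
have y0p : enorm (y0 - p) <= d + theta.
  have := enorm_dist3 (y0 + t *: u) y0 p; rewrite [enorm (y0 - (_ + _))]enormC yy.
  rewrite -(proj_set_dist pp).
  have := dist_triangle M0 cM (y0 + t *: u) y0; rewrite yy -/d.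
  by lra.
have [q qq pq] := near _ Mp y0p.
have ha : n ^+ 2 - n * ((n - mu * d) / 4) <= dot (y0 - p) u.
  rewrite -(subrKA q) dotDl.
  have := obt _ qq; rewrite -enorm_sqr -/n => h1.
  have := ge_dot (q - p) u; rewrite enormC -/n => h2.
  have := ler_wpM2r (ltW n0) (ltW pq).
  by lra.
have hb : d ^+ 2 <= dot (y0 - p) (y0 - p).
  by rewrite -enorm_sqr ler_sqr ?nnegrE ?enorm_ge0 ?(ltW d0)// dist_le.
have : dot (y0 + t *: u - p) (y0 + t *: u - p) <= (d + mu * (t * n)) ^+ 2.
  rewrite -enorm_ler_sqr//.
  by rewrite addr_ge0 ?(ltW d0)// mulr_ge0// mulr_ge0 ?(ltW n0)// ltW.
rewrite addrAC [leLHS]dot_sqrD dotZl !dotZr -[dot u u]enorm_sqr -/n => h1.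
have h2 := ler_wpM2l (ltW t0) ha.
have h3 : t * (t * (mu ^+ 2 * n ^+ 2)) < t * g by rewrite ltr_pM2l.
have h4 : 0 <= t ^+ 2 * n ^+ 2 by rewrite mulr_ge0 ?sqr_ge0.
have h5 : 0 < t * g by rewrite mulr_gt0.
by rewrite /g in h3 h5; lra.
Qed.

End LocalMax.

(** * Second order expansion of C^2 maps *)

Section Calculus.
Context {R : realType} {D : nat}.
Implicit Types (x y w h u v : 'rV[R]_D) (U : set 'rV[R]_D)
  (f : 'rV[R]_D -> 'rV[R]_D).

Lemma is_derive_dot_line f w h v (t : R) : differentiable f (w + t *: h) ->
  is_derive t (1 : R) (fun s : R => dot (f (w + s *: h)) v)
    (dot ('D_h f (w + t *: h)) v).
Proof.
move=> df; have dfh : derivable f (w + t *: h) h by exact: diff_derivable.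
have cv : (fun s : R => s^-1 *: (dot (f (w + (s *: (1 : R) + t) *: h)) v
    - dot (f (w + t *: h)) v)) s @[s --> 0^'] --> dot ('D_h f (w + t *: h)) v.
  rewrite (_ : (fun s : R => _) = (fun u => dot u v) \o
     (fun s : R => s^-1 *: ((f \o shift (w + t *: h)) (s *: h) - f (w + t *: h)))).
    apply: (@continuous_cvg _ _ _ _ _ _ (fun u => dot u v)).
      exact: continuous_dotl.
    exact: dfh.
  apply/funext => s /=; rewrite dotZl dotBl; congr (_ * (dot (f _) v - _)).
  by rewrite scaler1 scalerDl addrCA.
split; first by apply/cvg_ex; exists (dot ('D_h f (w + t *: h)) v).
exact: cvg_lim.
Qed.

(** Pairing with a fixed v reduces a vector-valued map to a real function. Norm bounds are recovered
    by taking for v the very vector to be bounded, through [enorm_le_self]. *)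
Lemma mean_value_dot f w h v :
    (forall t : R, 0 <= t <= 1 -> differentiable f (w + t *: h)) ->
  exists2 t : R, 0 <= t <= 1 &
    dot (f (w + h) - f w) v = dot ('D_h f (w + t *: h)) v.
Proof.
move=> df.
have [] := @MVT_segment R (fun s => dot (f (w + s *: h)) v)
  (fun s => dot ('D_h f (w + s *: h)) v) 0 1 ler01.
- move=> t; rewrite in_itv/= => /andP[t0 t1].
  by apply: is_derive_dot_line; apply: df; rewrite !ltW.
- apply: derivable_within_continuous => t; rewrite in_itv/= => t01.
  by case: (is_derive_dot_line v (df _ t01)).
move=> t; rewrite in_itv/= => t01; rewrite subr0 mulr1 scale1r scale0r addr0.
by rewrite -dotBl; exists t.
Qed.

Lemma derive_sum_delta f w h : differentiable f w ->
  'D_h f w = \sum_(i < D) h 0 i *: 'D_('e_i) f w.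
Proof.
move=> df; rewrite deriveE// {1}(row_sum_delta h) linear_sum.
by apply: eq_bigr => i _; rewrite linearZ/= deriveE.
Qed.

Lemma eball_convex w0 (r : R) w h (t : R) : eball w0 r w -> eball w0 r (w + h) ->
  0 <= t <= 1 -> eball w0 r (w + t *: h).
Proof.
rewrite /eball/= => h1 h2 /andP[t0 t1].
rewrite (_ : w0 - (w + t *: h) = (1 - t) *: (w0 - w) + t *: (w0 - (w + h))).
  apply: le_lt_trans (enormD _ _) _; rewrite !enormZ !ger0_norm ?subr_ge0//.
  have [->|tn] := eqVneq t 0; first by rewrite subr0 mul1r mul0r addr0.
  have tp : 0 < t by rewrite lt_neqAle eq_sym tn.
  apply: (@lt_le_trans _ _ ((1 - t) * enorm (w0 - w) + t * r)).
    by rewrite ltrD2l ltr_pM2l.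
  have := ler_wpM2l (_ : 0 <= 1 - t) (ltW h1); rewrite subr_ge0 => /(_ t1).
  by lra.
by apply/rowP => i; rewrite !mxE; ring.
Qed.

Lemma dot_suml_le (a b : 'I_D -> R) (F : 'I_D -> 'rV[R]_D) (c : R) h v :
    (forall i, enorm (F i) <= b i * c) ->
  dot (\sum_(i < D) h 0 i *: F i) v <= enorm h * c * (\sum_(i < D) b i) * enorm v.
Proof.
move=> hF; rewrite dot_suml mulr_sumr mulr_suml; apply: ler_sum => i _.
rewrite dotZl; apply: le_trans (ler_norm _) _; rewrite normrM -!mulrA.
apply: ler_pM => //; first exact: coord_le_enorm.
apply: le_trans (cauchy_schwarz _ _) _.
by rewrite mulrA [c * _]mulrC ler_wpM2r ?enorm_ge0.
Qed.

Lemma enorm_le_self v (c : R) : 0 <= c -> dot v v <= c * enorm v -> enorm v <= c.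
Proof.
rewrite -enorm_sqr => c0; have [->//|n0] := eqVneq (enorm v) 0.
by rewrite expr2 ler_pM2r// lt_neqAle eq_sym n0 enorm_ge0.
Qed.

(** By continuity the partial derivatives exceed their norms at w0 by at most 1 on a small ball;
    that ball is convex, so the mean value theorem applies along its segments. *)
Lemma C1_locally_lipschitz U f w0 : open U -> is_Ck 1 U f -> U w0 ->
  exists r L : R, [/\ 0 < r, 0 <= L, eball w0 r `<=` U &
    forall w w', eball w0 r w -> eball w0 r w' ->
      enorm (f w - f w') <= L * enorm (w - w')].
Proof.
move=> oU [df cf] Uw0.
pose b i := enorm ('D_('e_i) f w0) + 1.
have : nbhs w0 (U `&` [set w | forall i, enorm ('D_('e_i) f w) <= b i]).
  apply: filterI; first exact: open_nbhs_nbhs.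
  apply: (@filter_forall _ _ (fun i w => enorm ('D_('e_i) f w) <= b i) (nbhs w0)).
  move=> i; have /cvgrPdist_le := cf 'e_i w0 Uw0.
  (* The Euclidean norm is at most [D] times the sup norm, so sup-norm precision [e] gives Euclidean
     precision 1. *)
  pose e := (D.+1%:R)^-1 : R; have e0 : 0 < e by rewrite invr_gt0.
  move=> /(_ e e0); apply: filterS => w /= hw.
  rewrite /b -lerBlDl.
  apply: (@le_trans _ _ (enorm ('D_('e_i) f w0 - 'D_('e_i) f w))).
    rewrite lerBlDl -{1}(subrK ('D_('e_i) f w0) ('D_('e_i) f w)).
    by rewrite enormC addrC enormD.
  apply: le_trans (enorm_le_norm _) _.
  apply: le_trans (ler_wpM2l (ler0n _ _) hw) _.
  by rewrite /e ler_pdivrMr// mul1r ler_nat.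
move=> /nbhs_eballP[r r0 hr].
have L0 : 0 <= \sum_i b i.
  by apply: sumr_ge0 => i _; rewrite addr_ge0 ?enorm_ge0.
exists r, (\sum_i b i); split => // [w /hr[]//|w' w hw' hw].
have e : w' = w + (w' - w) by rewrite addrC subrK.
have [|t t01 ht] := @mean_value_dot f w (w' - w) (f w' - f w).
  by move=> t t01; apply: df; apply: (hr _ (eball_convex hw _ t01)).1; rewrite -e.
apply: enorm_le_self; first by rewrite mulr_ge0 ?enorm_ge0.
move: ht; rewrite -e => ->.
have [Ut bt] : U (w + t *: (w' - w)) /\
    forall i, enorm ('D_('e_i) f (w + t *: (w' - w))) <= b i.
  by apply: hr; apply: eball_convex => //; rewrite -e.
rewrite derive_sum_delta; last exact: df.
rewrite [(\sum_i b i) * _]mulrC -[enorm (w' - w)]mulr1.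
by apply: dot_suml_le => // i; rewrite mulr1.
Qed.

(** The partial derivatives are C^1, hence locally Lipschitz. The mean value theorem evaluates them
    at an intermediate point, and the Lipschitz bound compares this with their values at w. *)
Lemma C2_second_order U f w0 : open U -> is_Ck 2 U f -> U w0 ->
  exists r K : R, [/\ 0 < r, 0 <= K, eball w0 r `<=` U &
    forall w w', eball w0 r w -> eball w0 r w' ->
      enorm (f w' - f w - \sum_(i < D) (w' - w) 0 i *: 'D_('e_i) f w)
        <= K * enorm (w' - w) ^+ 2 /\
      forall i, enorm ('D_('e_i) f w' - 'D_('e_i) f w) <= K * enorm (w' - w)].
Proof.
move=> oU [df C1f] Uw0.
have loc i : exists rL : R * R, [/\ 0 < rL.1, 0 <= rL.2, eball w0 rL.1 `<=` U &
    forall w w', eball w0 rL.1 w -> eball w0 rL.1 w' ->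
      enorm ('D_('e_i) f w - 'D_('e_i) f w') <= rL.2 * enorm (w - w')].
  by have [r [L ?]] := C1_locally_lipschitz oU (C1f 'e_i) Uw0; exists (r, L).
pose rL i := sval (cid (loc i)).
have hrL i := svalP (cid (loc i)).
pose b i := (rL i).2.
have : nbhs w0 (U `&` [set w | forall i, eball w0 (rL i).1 w]).
  apply: filterI; first exact: open_nbhs_nbhs.
  apply: (@filter_forall _ _ (fun i w => eball w0 (rL i).1 w) (nbhs w0)) => i.
  by apply: nbhs_eball; case: (hrL i).
move=> /nbhs_eballP[r r0 hr].
have b0 i : 0 <= b i by case: (hrL i).
have K0 : 0 <= \sum_i b i by exact: sumr_ge0.
have lip i w w' : eball w0 r w -> eball w0 r w' ->
    enorm ('D_('e_i) f w' - 'D_('e_i) f w) <= b i * enorm (w' - w).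
  by move=> /hr[_ h1] /hr[_ h2]; case: (hrL i) => _ _ _ H; exact: H (h2 i) (h1 i).
exists r, (\sum_i b i); split => // [w /hr[]//|w w' hw hw']; split; last first.
  move=> i; apply: le_trans (lip i _ _ hw hw') _.
  by rewrite ler_wpM2r ?enorm_ge0// (bigD1 i)//= lerDl sumr_ge0.
have e : w' = w + (w' - w) by rewrite addrC subrK.
set T := \sum_(i < D) _; set h := w' - w.
have [|t t01 ht] := @mean_value_dot f w h (f w' - f w - T).
  by move=> t t01; apply: df; apply: (hr _ (eball_convex hw _ t01)).1; rewrite -e.
have hwt : eball w0 r (w + t *: h) by apply: eball_convex => //; rewrite -e.
apply: enorm_le_self; first by rewrite mulr_ge0 ?sqr_ge0.
rewrite dotBl; move: ht; rewrite -e => ->; rewrite -dotBl.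
rewrite derive_sum_delta; last by apply: df; exact: (hr _ hwt).1.
rewrite -sumrB; under eq_bigr do rewrite -scalerBr.
rewrite [(\sum_i b i) * _]mulrC expr2.
apply: dot_suml_le => // i; apply: le_trans (lip i _ _ hw hwt) _.
rewrite addrAC subrr add0r enormZ ler_wpM2l// ger0_norm; last by case/andP: t01.
by rewrite ler_piMl ?enorm_ge0//; case/andP: t01.
Qed.

End Calculus.

(** * Approximate tangent spaces *)

Section Submanifold.
Context {R : realType} {D : nat}.
Implicit Types (x y z b v w : 'rV[R]_D) (M : set 'rV[R]_D) (q s : seq 'rV[R]_D).

(** For orthonormal q, the squared length of the projection of v on the span of q. *)
Definition coords q v : R := \sum_(x <- q) dot v x ^+ 2.

(** Orthogonal projection on the span of q as soon as it fixes the members of q. That condition is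
    used below in place of orthonormality because it tolerates zero vectors in q. *)
Definition expansion q v := \sum_(x <- q) dot v x *: x.

Lemma expansion_dotC q v w : dot (expansion q v) w = dot v (expansion q w).
Proof.
rewrite [RHS]dotC /expansion !dot_suml.
by apply: eq_bigr => x _; rewrite !dotZl (dotC x w) (dotC x v) mulrC.
Qed.

Lemma expansion_coords q v : dot (expansion q v) v = coords q v.
Proof.
rewrite /expansion dot_suml; apply: eq_bigr => x _.
by rewrite dotZl (dotC x) expr2.
Qed.

Lemma expansionD q v w : expansion q (v + w) = expansion q v + expansion q w.
Proof.
rewrite /expansion -big_split; apply: eq_bigr => x _.
by rewrite /= dotDl scalerDl.
Qed.

Lemma expansionZ q (a : R) v : expansion q (a *: v) = a *: expansion q v.
Proof. by rewrite scaler_sumr; apply: eq_bigr => x _; rewrite dotZl scalerA. Qed.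

Lemma expansion0 q : expansion q 0 = 0.
Proof. by have := expansionZ q 0 0; rewrite !scale0r. Qed.

Lemma expansion_nil v : expansion [::] v = 0.
Proof. by rewrite /expansion big_nil. Qed.

Lemma expansion_cons a q v : expansion (a :: q) v = dot v a *: a + expansion q v.
Proof. by rewrite /expansion big_cons. Qed.

Lemma expansion_id q : {in q, forall x, expansion q x = x} ->
  forall v, expansion q (expansion q v) = expansion q v.
Proof.
move=> qid v.
(* The induction shrinks only the list of summands; the outer projection stays that of q. *)
have gen q' : {subset q' <= q} -> expansion q (expansion q' v) = expansion q' v.
  elim: q' => [_|x q' IH sub]; first by rewrite expansion_nil expansion0.
  rewrite expansion_cons expansionD expansionZ qid ?sub ?mem_head// IH// => y yq.
  by rewrite sub// in_cons yq orbT.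
exact: gen.
Qed.

(** Bessel's inequality: |v - P v|^2 >= 0 for the symmetric idempotent P = [expansion q]. *)
Lemma coords_le q v : {in q, forall x, expansion q x = x} ->
  coords q v <= dot v v.
Proof.
move=> qid; rewrite -expansion_coords.
have := dot_ge0 (v - expansion q v); rewrite dotBl !dotBr.
have -> : dot (expansion q v) (expansion q v) = dot (expansion q v) v.
  by rewrite expansion_dotC expansion_id// expansion_dotC.
by rewrite (dotC v); lra.
Qed.

(* Gram-Schmidt; a vector depending on its predecessors gives 0 = 0^-1 *: 0. *)
Lemma gram_schmidt s : exists q, [/\ size q = size s,
  {in q, forall x, expansion q x = x} & {in s, forall x, expansion q x = x}].
Proof.
elim: s => [|b s [q [sq qid sid]]]; first by exists [::].
pose w := b - expansion q b; pose a := (enorm w)^-1 *: w.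
have qw : expansion q w = 0.
  by rewrite /w expansionD -scaleN1r expansionZ expansion_id// scaleN1r subrr.
have qa : expansion q a = 0 by rewrite expansionZ qw scaler0.
have aE v : expansion q v = v -> dot v a = 0.
  by move=> <-; rewrite expansion_dotC qa dot0r.
have fixq v : expansion q v = v -> expansion (a :: q) v = v.
  by move=> e; rewrite expansion_cons aE// scale0r add0r.
have waa : dot w a *: a = w.
  rewrite dotZr scalerA -enorm_sqr.
  have [/enorm_eq0 ->|n0] := eqVneq (enorm w) 0; first by rewrite scaler0.
  by rewrite mulrAC -expr2 exprVn mulVf ?expf_neq0// scale1r.
exists (a :: q); split; first by rewrite /= sq.
  move=> v; rewrite in_cons => /predU1P[->|vq]; last by apply/fixq/qid.
  rewrite expansion_cons qa addr0 {2}/a dotZl -scalerA -/a.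
  by rewrite dotC [in dot _ w]dotC waa.
move=> v; rewrite in_cons => /predU1P[->|vs]; last by apply/fixq/sid.
have bE : b = w + expansion q b by rewrite subrK.
rewrite expansion_cons {1}bE dotDl (aE (expansion q b)) ?expansion_id// addr0 waa.
by rewrite subrK.
Qed.

(** Testing with a small t of the sign of g makes the linear term beat the quadratic one unless g =
    0. *)
Lemma linear_le_quadratic (g C t0 : R) : 0 < t0 ->
  (forall t, `|t| < t0 -> t * g <= C * t ^+ 2) -> g = 0.
Proof.
move=> t00 h; apply/eqP; rewrite -normr_eq0; apply/negPn/negP => g0.
have gp : 0 < `|g| by rewrite lt_neqAle eq_sym g0 normr_ge0.
have [|t tp /(_ t)] := @exists_small_scale R [:: (1, t0); (C, `|g|)].
  by rewrite /= t00 gp.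
rewrite lexx ltW//= mulr1 => /(_ isT) /and3P[tt tC _].
have := h (Num.sg g * t).
rewrite normrM (gtr0_norm tp) normr_sg -normr_eq0 g0 mul1r => /(_ tt).
rewrite mulrAC -normrEsg exprMn sqr_sg -normr_eq0 g0 mul1r expr2.
by rewrite mulrA ler_pM2r// [C * t]mulrC leNgt tC.
Qed.

(** All that is needed from charts: [F x] is the tangent frame at x given by the first m partial
    derivatives of [psi], and [h x b] holds the coordinate increments from x to b. The last clause
    says that z - x is normal to M when x is a projection of z. *)
Lemma C2_chart m M x0 : C2_submanifold m M -> M x0 ->
  exists (r K : R) (h : 'rV[R]_D -> 'rV[R]_D -> 'I_m -> R)
      (F : 'rV[R]_D -> 'I_m -> 'rV[R]_D), [/\ 0 < r, 0 <= K &
    forall x b, M x -> M b -> eball x0 r x -> eball x0 r b ->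
      [/\ forall i, `|h x b i| <= K * enorm (b - x),
          enorm (b - x - \sum_(i < m) h x b i *: F x i) <= K * enorm (b - x) ^+ 2,
          forall i, enorm (F b i - F x i) <= K * enorm (b - x) &
          forall z i, proj_set M z x -> dot (F x i) (z - x) = 0]].
Proof.
move=> [mD] /[apply] -[U [W [phi [psi [[oU Ux0] oW [C2phi C2psi] [UW WU] UM]]]]].
have [r1 [K1 [r10 K10 W1 hpsi]]] := C2_second_order oW C2psi (UW _ Ux0).1.
have [] := @C1_locally_lipschitz _ _ U phi x0 => //.
  case: C2phi => dphi C1; split => // v x Ux.
  by apply: differentiable_continuous; case: (C1 v) => /(_ x Ux).
move=> r2 [L [r20 L0 U2 hphi]].
have [|r r0 /(_ r)] := @exists_small_scale R [:: (1, r2); (L, r1)].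
  by rewrite /= r20 r10.
rewrite lexx ltW//= mulr1 => /(_ isT) /and3P[rr2 rL _].
have inU x : eball x0 r x -> [/\ U x, eball x0 r2 x & eball (phi x0) r1 (phi x)].
  move=> hx; have hx2 : eball x0 r2 x by exact: lt_trans hx rr2.
  split; [exact: U2 | by [] |].
  apply: le_lt_trans rL; apply: le_trans (hphi _ _ (eball_center _ r20) hx2) _.
  by rewrite mulrC ler_wpM2r// ltW.
pose wd := @widen_ord m D mD.
pose F x (i : 'I_m) := 'D_('e_(wd i)) psi (phi x).
pose h x b (i : 'I_m) := (phi b - phi x) 0 (wd i).
(* The summands serve, in order, the Taylor remainder, the variation of the frame and the coordinate
   increments. *)
exists r, (K1 * L ^+ 2 + K1 * L + L), h, F; split => //.
  by rewrite !addr_ge0// mulr_ge0// sqr_ge0.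
move=> x b Mx Mb hx hb.
have [Ux x2 wx] := inU _ hx; have [Ub b2 wb] := inU _ hb.
have [second D1] := hpsi _ _ wx wb.
have lip : enorm (phi b - phi x) <= L * enorm (b - x) by exact: hphi.
have n0 := enorm_ge0 (b - x).
have K1L0 : 0 <= K1 * L by exact: mulr_ge0.
have K1L20 : 0 <= K1 * L ^+ 2 by rewrite mulr_ge0 ?sqr_ge0.
split.
- move=> i; apply: le_trans (coord_le_enorm _ _) _; apply: le_trans lip _.
  by rewrite ler_wpM2r// lerDr addr_ge0.
- have -> : \sum_(i < m) h x b i *: F x i =
      \sum_(i < D) (phi b - phi x) 0 i *: 'D_('e_i) psi (phi x).
    (* Coordinates of index at least m vanish at both points of M. *)
    rewrite (bigID (fun i : 'I_D => (i < m)%N))/= [X in _ + X]big1 ?addr0.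
      by rewrite (big_ord_narrow mD).
    move=> i; rewrite -leqNgt => mi; rewrite !mxE.
    by rewrite ((UM _ Ub).1 Mb i mi) ((UM _ Ux).1 Mx i mi) subrr scale0r.
  rewrite (UW _ Ub).2 (UW _ Ux).2 in second.
  apply: le_trans second _.
  apply: (@le_trans _ _ (K1 * (L * enorm (b - x)) ^+ 2)).
    by rewrite ler_wpM2l// ler_sqr ?nnegrE ?mulr_ge0 ?enorm_ge0.
  rewrite exprMn mulrA ler_wpM2r ?sqr_ge0//.
  by rewrite -addrA lerDl addr_ge0.
- move=> i; apply: le_trans (D1 (wd i)) _.
  apply: (@le_trans _ _ (K1 * (L * enorm (b - x)))); first by rewrite ler_wpM2l.
  by rewrite mulrA ler_wpM2r// addrAC lerDr addr_ge0.
move=> z i px.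
set w := phi x in wx wb second D1 lip; set e : 'rV[R]_D := 'e_(wd i).
set G := F x i; set g := dot G (z - x).
have ne : enorm e = 1.
  rewrite /enorm (bigD1 (wd i))//= big1 ?addr0 ?mxE ?eqxx ?expr1n ?sqrtr1//.
  by move=> j ji; rewrite mxE eqxx (negbTE ji) expr0n.
have t00 : 0 < Num.min 1 (r1 - enorm (phi x0 - w)).
  by rewrite lt_min ltr01 subr_gt0.
(* Normality: for small t of either sign the point [c] of M with chart coordinates [w + t *: e] is
   no closer to z than x is. Expanding |z - c|^2 bounds t g by a multiple of t^2. *)
apply: (@linear_le_quadratic g
  (K1 * enorm (z - x) + 2^-1 * (enorm G + K1) ^+ 2) _ t00) => t.
rewrite lt_min => /andP[t1 tr].
have wt : eball (phi x0) r1 (w + t *: e).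
  rewrite /eball/= opprD addrA; apply: le_lt_trans (enormD _ _) _.
  by rewrite enormN enormZ ne mulr1 -ltrBrDl.
have [Uc phic] := WU _ (W1 _ wt).
set c := psi (w + t *: e) in Uc phic.
have Mc : M c.
  apply/(UM _ Uc) => j mj; rewrite phic !mxE ((UM _ Ux).1 Mx j mj) add0r eqxx.
  case: eqP => [ji|_]; last by rewrite mulr0.
  by move: mj; rewrite ji /= leqNgt ltn_ord.
have [sec _] := hpsi _ _ wx wt.
have wE : w + t *: e - w = t *: e by rewrite addrC addKr.
rewrite -/c (UW _ Ux).2 wE enormZ ne mulr1 in sec.
have Te : \sum_(j < D) (t *: e) 0 j *: 'D_('e_j) psi w = t *: G.
  rewrite (bigD1 (wd i))//= big1 ?addr0; first by rewrite !mxE !eqxx mulr1.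
  by move=> j ji; rewrite !mxE eqxx (negbTE ji) mulr0 scale0r.
rewrite Te real_normK ?num_real// in sec.
have [_ /(_ c Mc)] := (proj_setP M z x).1 px.
rewrite enorm_le_sqr (_ : z - c = (z - x) - (c - x)); last first.
  by rewrite opprB addrA subrK.
rewrite [leRHS]dotBl ![dot _ (z - x - _)]dotBr (dotC (z - x) (c - x)).
move: sec; set E := c - x - t *: G => sec.
have cxE : c - x = t *: G + E by rewrite [RHS]addrC subrK.
have nE : enorm E <= K1 * t ^+ 2 by [].
have ncx : enorm (c - x) <= `|t| * (enorm G + K1).
  rewrite cxE; apply: le_trans (enormD _ _) _; rewrite enormZ mulrDr lerD2l.
  apply: le_trans nE _; rewrite mulrC ler_wpM2r// -real_normK ?num_real// expr2.
  by rewrite ler_piMl// ltW.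
have ncx2 : dot (c - x) (c - x) <= t ^+ 2 * (enorm G + K1) ^+ 2.
  rewrite -enorm_sqr -[t ^+ 2]real_normK ?num_real// -exprMn.
  by rewrite ler_sqr ?nnegrE ?mulr_ge0 ?addr_ge0 ?enorm_ge0.
have gE : dot (c - x) (z - x) = t * g + dot E (z - x).
  by rewrite {1}cxE dotDl dotZl.
have := ge_dot E (z - x).
have := ler_wpM2r (enorm_ge0 (z - x)) nE.
rewrite gE; lra.
Qed.

(** For b near x, the first order part of b - x is tangent, hence orthogonal to z - x, and only the
    quadratic remainder counts. For b far from x, Cauchy-Schwarz suffices. *)
Lemma normal_quadratic m M : compact M -> C2_submanifold m M ->
  exists2 K : R, 0 < K & forall z x b, proj_set M z x -> M b ->
    `|dot (b - x) (z - x)| <= K * enorm (z - x) * enorm (b - x) ^+ 2.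
Proof.
move=> cM C2M.
(* Using r for the range and its inverse for the constant makes the property monotone in r. *)
have [||r r0 hr] := @compact_uniform_radius R D M (fun r x =>
  forall z b, proj_set M z x -> M b -> enorm (b - x) < r ->
    `|dot (b - x) (z - x)| <= r^-1 * enorm (z - x) * enorm (b - x) ^+ 2) cM.
- move=> r r' x /andP[r'0 r'r] h z b px Mb br'.
  apply: le_trans (h z b px Mb (lt_le_trans br' r'r)) _.
  rewrite -!mulrA ler_wpM2r ?mulr_ge0 ?enorm_ge0 ?sqr_ge0//.
  by rewrite lef_pV2 ?posrE// (lt_le_trans r'0).
- move=> x0 Mx0; have [r [K [h [F [r0 K0 chart]]]]] := C2_chart C2M Mx0.
  have [|t t0 /(_ t)] := @exists_small_scale R [:: (2, r); (K, 1)].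
    by rewrite /= r0 ltr01.
  rewrite lexx ltW//= => /(_ isT) /and3P[tr tK _].
  exists t => // x Mx hx z b px Mb bt.
  have xr : eball x0 r x by apply: lt_trans hx _; lra.
  have br : eball x0 r b.
    apply: le_lt_trans (enorm_dist3 x _ _) _; rewrite (enormC x).
    by move: hx; rewrite /eball/=; lra.
  have [_ quad _ orth] := chart x b Mx Mb xr br.
  have -> : dot (b - x) (z - x) =
      dot (b - x - \sum_(i < m) h x b i *: F x i) (z - x).
    rewrite [RHS]dotBl dot_suml big1 ?subr0// => i _.
    by rewrite dotZl orth// mulr0.
  apply: le_trans (cauchy_schwarz _ _) _.
  rewrite mulrAC ler_wpM2r ?enorm_ge0//; apply: le_trans quad _.
  rewrite ler_wpM2r ?sqr_ge0// -div1r ler_pdivlMr// mulrC.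
  exact: ltW.
exists r^-1; first by rewrite invr_gt0.
move=> z x b px Mb; have [lt|le] := ltP (enorm (b - x)) r.
  by apply: hr => //; case: px.
apply: le_trans (cauchy_schwarz _ _) _.
rewrite mulrC -mulrA mulrCA ler_wpM2l ?enorm_ge0// expr2 mulrA.
by rewrite ler_peMl ?enorm_ge0// mulrC ler_pdivlMr// mul1r.
Qed.

(** The span of q is an approximate tangent space: chords of M near x keep at least a quarter of
    their squared length in the coordinates q. *)
Definition almost_flat m M (r : R) x := exists q, [/\ size q = m,
  forall v, coords q v <= dot v v &
  forall y y', M y -> M y' -> eball x r y -> eball x r y' ->
    dot (y' - y) (y' - y) <= 4 * coords q (y' - y)].

(** For all x near x0, q is the orthonormalised tangent frame at x0. A chord is V + E with V in its
    span and E at most a quarter of the chord in norm. *)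
Lemma submanifold_almost_flat m M : compact M -> C2_submanifold m M ->
  exists2 r, 0 < r & forall x, M x -> almost_flat m M r x.
Proof.
move=> cM C2M; apply: compact_uniform_radius => // [r r' x /andP[r'0 r'r]|].
  move=> [q [sq qle qge]]; exists q; split => // y y' My My' hy hy'.
  by apply: qge => //; [exact: lt_le_trans hy r'r | exact: lt_le_trans hy' r'r].
move=> x0 Mx0; have [r [K [h [F [r0 K0 chart]]]]] := C2_chart C2M Mx0.
have [|t t0 /(_ t)] := @exists_small_scale R
    (* Points of the t-ball of x lie within 2 t of x0. The Taylor remainder is then at most 4 t K n
       and the change of frame costs at most 2 t m K^2 n, together at most n / 4. *)
    [:: (2, r); (4 * K + 2 * m%:R * K ^+ 2, 4^-1)].
  by rewrite /= r0 invr_gt0 ltr0n.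
rewrite lexx ltW//= => /(_ isT) /and3P[tr tK _].
exists t => // x Mx hx.
have [q [sq qid qF]] := gram_schmidt [seq F x0 i | i <- enum 'I_m].
exists q; split; [by rewrite sq size_map size_enum_ord| |].
  by move=> v; exact: coords_le.
have in2t y : eball x t y -> enorm (x0 - y) < 2 * t.
  move=> hy; apply: le_lt_trans (enorm_dist3 x _ _) _.
  by move: hx hy; rewrite /eball/=; lra.
move=> y y' My My' /in2t hy /in2t hy'.
have [||] := chart y y' My My'; try by rewrite /eball/=; lra.
move=> hle quad _ _.
have [||_ _ FF _] := chart x0 y Mx0 My; first exact: eball_center.
  by rewrite /eball/=; lra.
set V := \sum_(i < m) h y y' i *: F x0 i.
set n := enorm (y' - y).
have n0 : 0 <= n := enorm_ge0 _.
pose E := y' - y - V.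
have nE : enorm E <= n / 4.
  rewrite /E (_ : y' - y - V = (y' - y - \sum_(i < m) h y y' i *: F y i)
      + \sum_(i < m) h y y' i *: (F y i - F x0 i)); last first.
    have -> : \sum_(i < m) h y y' i *: (F y i - F x0 i) =
        \sum_(i < m) h y y' i *: F y i - V.
      by rewrite -sumrB; apply: eq_bigr => i _; rewrite scalerBr.
    by rewrite subrKA.
  apply: le_trans (enormD _ _) _.
  have s1 : enorm (y' - y) <= 4 * t.
    by apply: le_trans (enorm_dist3 x0 _ _) _; rewrite (enormC y'); lra.
  have s2 : enorm (\sum_(i < m) h y y' i *: (F y i - F x0 i))
      <= m%:R * (K * n * (K * (2 * t))).
    apply: le_trans (enorm_sum _ _) _.
    rewrite mulr_natl -[X in _ *+ X]card_ord -sumr_const; apply: ler_sum => i _.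
    rewrite enormZ; apply: ler_pM => //; first exact: enorm_ge0.
    by apply: le_trans (FF i) _; rewrite ler_wpM2l// enormC ltW.
  have s3 : K * n ^+ 2 <= K * (4 * t) * n.
    by rewrite expr2 mulrA ler_wpM2r// ler_wpM2l.
  have s4 : t * (4 * K + 2 * m%:R * K ^+ 2) * n <= 4^-1 * n.
    by rewrite ler_wpM2r// ltW.
  by move: quad; rewrite -/n => quad; lra.
have VE : expansion q V = V.
  apply: (big_rec (fun v => expansion q v = v)) => [|j v _ IH].
    by rewrite expansion0.
  by rewrite expansionD expansionZ IH qF// map_f// mem_enum.
have yE : y' - y = V + E by rewrite [RHS]addrC subrK.
(* Hence [coords q (y' - y)] is n^2 - |E|^2 + [coords q E], at least 15/16 of n^2. *)
have cE : coords q (y' - y) = dot V V + 2 * dot V E + coords q E.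
  rewrite -!expansion_coords yE expansionD VE dotDl ![dot _ (V + _)]dotDr.
  by rewrite expansion_dotC VE (dotC E V); ring.
have := dot_sqrD V E; rewrite -yE -[dot (y' - y) _]enorm_sqr -/n -[dot E E]enorm_sqr.
have : enorm E ^+ 2 <= n ^+ 2 / 16.
  rewrite (_ : n ^+ 2 / 16 = (n / 4) ^+ 2); last by field.
  by rewrite ler_sqr ?nnegrE ?enorm_ge0 ?divr_ge0.
have : 0 <= coords q E by apply: sumr_ge0 => i _; exact: sqr_ge0.
have := sqr_ge0 n; rewrite cE; lra.
Qed.

End Submanifold.

(** * Critical points of subsets *)

Section Stability.
Context {R : realType} {D : nat}.
Implicit Types (x y z a b p v w : 'rV[R]_D) (A M : set 'rV[R]_D).

Lemma finite_uniform_pos (T : eqType) (F : set T) (P : R -> T -> Prop) :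
    finite_set F -> (forall r r' (t : T), 0 < r' <= r -> P r t -> P r' t) ->
    (forall t, F t -> exists2 r, 0 < r & P r t) ->
  exists2 r, 0 < r & forall t, F t -> P r t.
Proof.
move=> /finite_seqP[s ->] mono; elim: s => [|x s IH] h.
  by exists 1 => // t /=; rewrite in_nil.
have [|r r0 hr] := IH; first by move=> y ys; apply: h; rewrite /= in_cons ys orbT.
have [|r' r'0 hr'] := h x; first by rewrite /= mem_head.
have m0 : 0 < Num.min r r' by rewrite lt_min r0.
exists (Num.min r r') => // y /=; rewrite in_cons => /predU1P[->|ys].
  by apply: mono hr'; rewrite m0 ge_min lexx orbT.
by apply: mono (hr y ys); rewrite m0 ge_min lexx.
Qed.

Lemma compact_diameter M : compact M ->
  exists2 L : R, 0 < L & forall x y, M x -> M y -> enorm (x - y) <= L.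
Proof.
move=> cM; have [[x0 Mx0]|no] := pselect (M !=set0); last first.
  by exists 1 => // x y Mx; case: no; exists x.
have [p Mp hp] := EVT_max_rV (ex_intro _ x0 Mx0) cM
  (continuous_within (@continuous_distr _ _ x0)).
set l := enorm (x0 - p); exists (2 * l + 1).
  by have := enorm_ge0 (x0 - p); rewrite -/l; lra.
move=> x y Mx My; apply: le_trans (enorm_dist3 x0 _ _) _; rewrite (enormC x).
have : enorm (x0 - x) <= l by apply: hp; rewrite inE.
have : enorm (x0 - y) <= l by apply: hp; rewrite inE.
by lra.
Qed.

(** Some projection p of z on A satisfies <p - z, z - x> >= 0, so p is at least as far from x as z
    is. *)
Lemma crit_in_diameter A M z x (L : R) : A !=set0 -> compact A -> A `<=` M ->
    (forall x y, M x -> M y -> enorm (x - y) <= L) -> crit A z -> M x ->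
  enorm (z - x) <= L.
Proof.
move=> A0 cA AM diam Az Mx.
have [p [Ap _] h] := crit_direction (z - x) A0 cA Az.
apply: le_trans (diam p x (AM _ Ap) Mx).
rewrite enorm_le_sqr (_ : p - x = (p - z) + (z - x)); last by rewrite subrKA.
by rewrite [leRHS]dot_sqrD; have := dot_ge0 (p - z); lra.
Qed.

(** Expand |y - p|^2 at a projection p of z that makes a non-obtuse angle with y - z. *)
Lemma crit_dist_sqr_le A z y : A !=set0 -> compact A -> crit A z ->
  dist A y ^+ 2 <= dist A z ^+ 2 + enorm (y - z) ^+ 2.
Proof.
move=> A0 cA Az; have [p pp h] := crit_direction (y - z) A0 cA Az.
apply: (@le_trans _ _ (enorm (y - p) ^+ 2)).
  by rewrite ler_sqr ?nnegrE ?enorm_ge0 ?dist_ge0// dist_le//; case: pp.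
rewrite (proj_set_dist pp) (enormC z) !enorm_sqr.
rewrite (_ : y - p = (y - z) - (p - z)); last by rewrite opprB subrKA.
rewrite [leLHS]dotBl ![dot _ (y - z - _)]dotBr (dotC (y - z) (p - z)).
by lra.
Qed.

(** A point b of A within eps of x is seen from z almost at a right angle at x, by the quadratic
    estimate, so Pythagoras holds up to order eps^2. *)
Lemma sqr_dist_sample A M z x (K eps : R) : 0 < K ->
    (forall z x b, proj_set M z x -> M b ->
      `|dot (b - x) (z - x)| <= K * enorm (z - x) * enorm (b - x) ^+ 2) ->
    A !=set0 -> compact A -> A `<=` M ->
    (forall x, M x -> exists2 y, A y & enorm (x - y) <= eps) ->
    proj_set M z x ->
  dist A z ^+ 2 <= enorm (z - x) ^+ 2 + (1 + 2 * K * enorm (z - x)) * eps ^+ 2.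
Proof.
move=> K0 quad A0 cA AM near px; have [Mx _] := px.
have [b Ab xb] := near x Mx.
have e0 : 0 <= eps := le_trans (enorm_ge0 _) xb.
apply: (@le_trans _ _ (enorm (z - b) ^+ 2)).
  by rewrite ler_sqr ?nnegrE ?enorm_ge0 ?dist_ge0// dist_le.
have := quad z x b px (AM _ Ab); rewrite ler_norml => /andP[h _].
rewrite [enorm (z - b) ^+ 2]enorm_sqr (_ : z - b = (z - x) - (b - x)); last first.
  by rewrite opprB subrKA.
rewrite [dot _ _]dotBl ![dot _ (z - x - _)]dotBr (dotC (z - x) (b - x)).
rewrite -!enorm_sqr.
have bx : enorm (b - x) ^+ 2 <= eps ^+ 2.
  by rewrite ler_sqr ?nnegrE ?enorm_ge0// enormC.
have : K * enorm (z - x) * enorm (b - x) ^+ 2 <= K * enorm (z - x) * eps ^+ 2.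
  by rewrite ler_wpM2l// mulr_ge0 ?enorm_ge0// ltW.
by lra.
Qed.

(** Let d = |z - x| and l = |a - x|^2, with a a projection of z on A chosen in the direction z - x.
    Then d^2 <= <a - x, z - x> <= K d l, so d <= K l. Expanding |z - a|^2 and using 4 K d <= 1 gives
    l <= 2 B eps^2. *)
Lemma crit_near_submanifold A M z x (K B eps : R) : 0 < K ->
    (forall z x b, proj_set M z x -> M b ->
      `|dot (b - x) (z - x)| <= K * enorm (z - x) * enorm (b - x) ^+ 2) ->
    A !=set0 -> compact A -> A `<=` M -> crit A z -> proj_set M z x ->
    dist A z ^+ 2 <= enorm (z - x) ^+ 2 + B * eps ^+ 2 -> 0 <= B ->
    4 * K * enorm (z - x) <= 1 ->
  enorm (z - x) <= 2 * K * B * eps ^+ 2.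
Proof.
move=> K0 quad A0 cA AM Az px distA B0 small.
set d := enorm (z - x) in distA small *.
have [d0|dn0] := eqVneq d 0.
  by rewrite d0; apply: mulr_ge0 (sqr_ge0 _); rewrite !mulr_ge0 ?(ltW K0).
have dp : 0 < d by rewrite lt_neqAle eq_sym dn0 enorm_ge0.
have [a pa h] := crit_direction (z - x) A0 cA Az.
have [Aa _] := pa.
have := quad z x a px (AM _ Aa); rewrite ler_norml -/d => /andP[_ up].
have e1 : dot (a - x) (z - x) = d ^+ 2 + dot (a - z) (z - x).
  by rewrite /d enorm_sqr -dotDl [z - x + _]addrC subrKA.
have e2 : dist A z ^+ 2 = d ^+ 2 + dot (a - x) (a - x) - 2 * dot (a - x) (z - x).
  rewrite (proj_set_dist pa) enorm_sqr /d enorm_sqr.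
  rewrite (_ : z - a = (z - x) - (a - x)); last by rewrite opprB subrKA.
  rewrite [LHS]dotBl ![dot _ (z - x - _)]dotBr (dotC (z - x) (a - x)); ring.
rewrite -enorm_sqr in e2; set l := enorm (a - x) ^+ 2 in e2 up *.
have l0 : 0 <= l by exact: sqr_ge0.
have dl : d <= K * l.
  have : d * d <= d * (K * l) by move: up; rewrite e1 expr2; lra.
  by rewrite ler_pM2l.
have : (4 * K * d) * l <= 1 * l by rewrite ler_wpM2r.
have : K * l <= K * (2 * (B * eps ^+ 2)).
  rewrite ler_wpM2l ?(ltW K0)//.
  have : (4 * K * d) * l <= 1 * l by rewrite ler_wpM2r.
  by lra.
by lra.
Qed.

(* The maximiser of y |-> dist M y - mu |y - z| on the ball of radius eps around
   z is interior because of crit_dist_sqr_le, hence mu-critical. *)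
Lemma crit_far_submanifold A M z (B mu eps : R) : M !=set0 -> compact M ->
    A !=set0 -> compact A -> A `<=` M -> crit A z ->
    dist A z ^+ 2 <= dist M z ^+ 2 + B * eps ^+ 2 -> 0 < eps -> 0 <= mu ->
    0 < dist M z -> (B + 1) * eps < 2 * dist M z * mu ->
  exists2 y, mu_crit mu M y & enorm (z - y) <= eps.
Proof.
move=> M0 cM A0 cA AM Az distA eps0 mu0 d0 large.
set d := dist M z in distA d0 large.
pose f y := dist M y - mu * enorm (y - z).
have cf : continuous f.
  move=> y; apply: (@continuousB _ _ _ (dist M) (fun y => mu * enorm (y - z)) y).
    exact: continuous_dist_set.
  by apply: continuousM; [exact: cst_continuous | exact: continuous_dist].
have B0 : ecball z eps !=set0 by exists z; rewrite /ecball/= subrr enorm0 ltW.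
have [y0 By0 ymax] :=
  EVT_max_rV B0 (@compact_ecball _ _ z eps) (continuous_within cf).
have {}By0 : enorm (z - y0) <= eps by move: By0; rewrite inE.
have fz : d + mu * enorm (y0 - z) <= dist M y0.
  have := ymax z; rewrite inE => /(_ (ltac:(by rewrite /ecball/= subrr enorm0 ltW))).
  by rewrite /f subrr enorm0 mulr0 subr0 -/d; lra.
have dy0 : 0 < dist M y0.
  by apply: lt_le_trans fz; rewrite ltr_wpDr// mulr_ge0 ?enorm_ge0.
(* At a boundary maximiser, (d + mu eps)^2 <= d^2 + (B + 1) eps^2, which [large] forbids. *)
have inner : enorm (z - y0) < eps.
  rewrite lt_neqAle By0 andbT; apply/eqP => e.
  rewrite enormC e in fz.
  have : dist M y0 <= dist A y0.
    have [p pp] := proj_set_neq0 A0 cA y0; rewrite (proj_set_dist pp).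
    by apply: dist_le => //; apply: AM; case: pp.
  have := crit_dist_sqr_le y0 A0 cA Az; rewrite enormC e => h1 h2.
  have h3 : (d + mu * eps) ^+ 2 <= dist A y0 ^+ 2.
    rewrite ler_sqr ?nnegrE ?dist_ge0//; first exact: le_trans fz h2.
    by rewrite addr_ge0 ?mulr_ge0// ltW.
  have h4 : (B + 1) * eps * eps < 2 * d * mu * eps by rewrite ltr_pM2r.
  by have := sqr_ge0 (mu * eps); lra.
exists y0 => //; split; first exact: dist_gt0_notin.
apply: (gen_grad_local_max (r := eps - enorm (z - y0))) => //.
- exact: dist_gt0_notin.
- by rewrite subr_gt0.
move=> y hy; have : f y <= f y0.
  apply: ymax; rewrite inE /ecball/=; apply: le_trans (enorm_dist3 y0 _ _) _.
  by rewrite (enormC y0); lra.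
have := ler_wpM2l mu0 (enorm_dist3 y0 y z).
by rewrite /f mulrDr; lra.
Qed.

End Stability.

(** * The subset stability property *)

Section SubsetStability.
Context {R : realType} {D : nat}.
Implicit Types (x y z a b p v w : 'rV[R]_D) (A M S : set 'rV[R]_D).

Lemma set_dist_lt S x (r : R) : (set_dist S x < r%:E)%E ->
  exists2 y, S y & enorm (x - y) < r.
Proof. by move=> /ereal_inf_lt[_ [y Sy <-]]; rewrite lte_fin => h; exists y. Qed.

Lemma finite_separated S : finite_set S ->
  exists2 s : R, 0 < s & forall z z', S z -> S z' -> z' <> z -> s <= enorm (z - z').
Proof.
move=> fS.
have [|z Sz|s s0 hs] := @finite_uniform_pos R _ S
  (fun s z => forall z', S z' -> z' <> z -> s <= enorm (z - z')) fS.
- move=> r r' z /andP[_ r'r] h z' Sz' z'z.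
  exact: le_trans r'r (h z' Sz' z'z).
- have [|z' Sz'|s s0 hs] := @finite_uniform_pos R _ S
    (fun s z' => z' <> z -> s <= enorm (z - z')) fS.
  + by move=> r r' z' /andP[_ r'r] h /h; exact: le_trans.
  + have [->|/eqP z'z] := eqVneq z' z; first by exists 1.
    exists (enorm (z - z')) => //; rewrite lt_neqAle enorm_ge0 andbT eq_sym.
    by apply/eqP => /enorm_eq0/eqP; rewrite subr_eq0 => /eqP/esym.
  by exists s.
by exists s => // z z' Sz; exact: hs.
Qed.

Lemma crit_away M : M !=set0 -> compact M -> condP2 M ->
  exists2 s : R, 0 < s & forall z, crit M z -> s <= dist M z.
Proof.
move=> M0 cM finZ; apply: finite_uniform_pos => // [r r' z /andP[_ r'r]|z].
  exact: le_trans.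
by move=> [nMz _]; exists (dist M z) => //; exact: dist_gt0.
Qed.

(** (P4) bounds an infimum: its being finite forces a critical point to exist, and finiteness of the
    critical set makes the infimum attained. *)
Lemma mu_crit_near_crit M : condP2 M -> condP4 M ->
  exists C mu0 : R, [/\ 0 < C, 0 < mu0 & forall mu y, 0 <= mu < mu0 ->
    mu_crit mu M y -> exists2 z, crit M z & enorm (y - z) <= C * mu].
Proof.
move=> finZ [C [mu0 [C0 /andP[mu00 _] h]]]; exists C, mu0; split => // mu y hmu hy.
have hd := h mu hmu y hy.
have Z0 : crit M !=set0.
  have [|z Zz _] := @set_dist_lt (crit M) y (C * mu + 1); last by exists z.
  by apply: le_lt_trans hd _; rewrite lte_fin ltrDl.
have [p pp] := proj_set_neq0 Z0 (finite_compact finZ) y.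
by case: pp => Zp e; exists p => //; rewrite -lee_fin e.
Qed.

Lemma simplex_vertices_finite S : simplex_vertices S -> finite_set S.
Proof. by move=> [k [p [-> _]]]; exact: finite_image. Qed.

(** There are finitely many critical points by (P2), each with finitely many projections by (P1), so
    one s can serve as radius and growth constant in every instance of (P3). *)
Lemma uniform_quadratic_growth M : condP1 M -> condP2 M -> condP3 M ->
  exists2 s : R, 0 < s & forall z0 x0 y, crit M z0 -> proj_set M z0 x0 -> M y ->
    enorm (y - x0) < s ->
    enorm (x0 - z0) ^+ 2 + s * enorm (y - x0) ^+ 2 <= enorm (y - z0) ^+ 2.
Proof.
move=> P1 finZ P3.
pose Q (s : R) z0 x0 := forall y, M y -> enorm (y - x0) < s ->
    enorm (x0 - z0) ^+ 2 + s * enorm (y - x0) ^+ 2 <= enorm (y - z0) ^+ 2.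
have monoQ r r' z0 x0 : 0 < r' <= r -> Q r z0 x0 -> Q r' z0 x0.
  move=> /andP[_ r'r] h y My hy; apply: le_trans (h y My (lt_le_trans hy r'r)).
  by rewrite lerD2l ler_wpM2r ?sqr_ge0.
have [|z0 Zz0|s s0 hs] := @finite_uniform_pos R _ _
  (fun s z0 => forall x0, proj_set M z0 x0 -> Q s z0 x0) finZ.
- by move=> r r' z0 r'r h x0 /h; exact: monoQ.
- apply: (finite_uniform_pos (simplex_vertices_finite (P1 z0 Zz0).1)).
    by move=> r r' x0; exact: monoQ.
  move=> x0 px0; have [del [al [del0 al0 h]]] := P3 z0 x0 Zz0 px0.
  exists (Num.min del al); first by rewrite lt_min del0.
  move=> y My; rewrite lt_min => /andP[hy _].
  apply: le_trans (h y _); last by split=> //; rewrite /eball/= enormC.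
  by rewrite lerD2l ler_wpM2r ?sqr_ge0// ge_min lexx orbT.
exists s; first exact: s0.
by move=> z0 x0 y Zz0 px0 My hy; exact: (hs z0 Zz0 x0 px0 y My hy).
Qed.

Lemma uniform_near_proj_set M (eta : R) : M !=set0 -> compact M -> condP2 M ->
    0 < eta ->
  exists2 theta : R, 0 < theta & forall z p, crit M z -> M p ->
    enorm (z - p) <= dist M z + theta ->
    exists2 q, proj_set M z q & enorm (p - q) < eta.
Proof.
move=> M0 cM finZ eta0.
have [|z _|s s0 hs] := @finite_uniform_pos R _ _ (fun theta z => forall p, M p ->
    enorm (z - p) <= dist M z + theta ->
    exists2 q, proj_set M z q & enorm (p - q) < eta) finZ.
- move=> r r' z /andP[_ r'r] h p Mp hp; apply: h => //.
  by apply: le_trans hp _; rewrite lerD2l.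
- exact: near_proj_set.
exists s; first exact: s0.
by move=> z p Zz Mp hp; exact: (hs z Zz p Mp hp).
Qed.

(* Comparing |a - z| with |x0 - z| instead of |a - z'| with |x0 - z'| turns the
   a priori bound of order sqrt eps on |a - x0| into one of order eps. *)
Lemma proj_near_crit M z z' x0 a (s B C eps : R) : 0 < s -> 0 <= B -> 0 <= C ->
    0 <= eps -> M !=set0 -> compact M -> proj_set M z' x0 ->
    enorm (x0 - z') ^+ 2 + s * enorm (a - x0) ^+ 2 <= enorm (a - z') ^+ 2 ->
    enorm (z - a) ^+ 2 <= dist M z ^+ 2 + B * eps ^+ 2 ->
    enorm (z - z') <= C * eps ->
  enorm (a - x0) <= ((2 * C + B) / s + 1) * eps.
Proof.
move=> s0 B0 C0 e0 M0 cM px growth ha zz'.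
set t := enorm (a - x0) in growth *.
have t0 : 0 <= t := enorm_ge0 _.
have CB0 : 0 <= 2 * C + B by rewrite addr_ge0// mulr_ge0.
rewrite leNgt; apply/negP => lt.
(* This turns the eps^2 error into one of order eps t, so that the inequality can be divided by
   t. *)
have et : eps <= t.
  apply/ltW; apply: le_lt_trans lt; rewrite ler_peMl// lerDr.
  by rewrite divr_ge0// ltW.
have h1 : dist M z ^+ 2 <= enorm (z - x0) ^+ 2.
  by rewrite ler_sqr ?nnegrE ?enorm_ge0 ?dist_ge0// dist_le//; case: px.
have h2 : enorm (z - a) ^+ 2 - enorm (z - x0) ^+ 2 =
    enorm (a - z') ^+ 2 - enorm (x0 - z') ^+ 2 - 2 * dot (a - x0) (z - z').
  have e y : enorm (z - y) ^+ 2 =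
      dot (z - z') (z - z') - 2 * dot (y - z') (z - z') + enorm (y - z') ^+ 2.
    rewrite !enorm_sqr (_ : z - y = (z - z') - (y - z')); last first.
      by rewrite opprB subrKA.
    rewrite [LHS]dotBl ![dot _ (z - z' - _)]dotBr (dotC (z - z') (y - z')).
    by ring.
  rewrite !e (_ : a - x0 = (a - z') - (x0 - z')); last by rewrite opprB subrKA.
  by rewrite [dot (a - z' - _) _]dotBl; ring.
have h3 : dot (a - x0) (z - z') <= t * (C * eps).
  by apply: le_trans (dot_le _ _) _; rewrite ler_wpM2l.
have h4 : B * eps ^+ 2 <= B * (eps * t).
  by rewrite expr2 ler_wpM2l// ler_wpM2l.
have h5 : s * t ^+ 2 <= t * ((2 * C + B) * eps).
  by move: h2; lra.
have tp : 0 < t.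
  by apply: le_lt_trans lt; rewrite mulr_ge0// addr_ge0// divr_ge0// ltW.
have h6 : s * t <= (2 * C + B) * eps.
  by rewrite -(ler_pM2l tp) mulrCA -expr2.
have : t <= (2 * C + B) / s * eps.
  by rewrite mulrAC ler_pdivlMr// mulrC.
by rewrite mulrDl mul1r in lt; lra.
Qed.

Lemma subset_stability_exists m M : M !=set0 -> compact M -> C2_submanifold m M ->
    condP1 M -> condP2 M -> condP3 M -> condP4 M ->
  exists C1 C2 C3 C4 C5 eps0 : R,
    [/\ [/\ 0 < C1, 0 < C2, 0 < C3, 0 < C4 & 0 < C5], 0 < eps0 &
        subset_stability M C1 C2 C3 C4 C5 eps0].
Proof.
move=> M0 cM C2M P1 finZ P3 P4.
have [K K0 quad] := normal_quadratic cM C2M.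
have [L L0 diam] := compact_diameter cM.
have [C [mu0 [C0 mu00 hP4]]] := mu_crit_near_crit finZ P4.
have [sig sig0 away] := crit_away M0 cM finZ.
have [s s0 growth] := uniform_quadratic_growth P1 finZ P3.
have [theta theta0 nearp] := uniform_near_proj_set M0 cM finZ s0.
(* B bounds the coefficient of eps^2 in [sqr_dist_sample], as critical points of A lie within L of
   M. C3 is such that [crit_far_submanifold] applies once 4 K [dist M z] > 1; C4 adds the radius eps
   to the (P4) bound for mu = C3 eps; C5 comes from [proj_near_crit]. *)
pose B := 1 + 2 * K * L.
have KL0 : 0 < 2 * K * L by rewrite !mulr_gt0.
have B0 : 0 < B by rewrite /B addr_gt0.
pose C1 := 2 * K * B.
pose C3 := 4 * K * (B + 1).
pose C4 := 1 + C * C3.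
pose C5 := (2 * C4 + B) / s + 1.
have C10 : 0 < C1 by rewrite !mulr_gt0.
have C30 : 0 < C3 by rewrite !mulr_gt0// addr_gt0.
have C40 : 0 < C4 by rewrite addr_gt0// mulr_gt0.
have C50 : 0 < C5.
  by rewrite addr_gt0// divr_gt0// addr_gt0// mulr_gt0.
have [|eps0 e00 he0] := @exists_small_scale R
  (* In order: (P4) applies; the next three conditions make (a) and (b) exclusive; the last puts the
     projections of z on A among the almost-projections of z'. *)
  [:: (C3, mu0); (C4, sig / 4); (C1, sig / 4); (1, 1); (2 * C4 + 1, theta)].
  by rewrite /= mu00 theta0 ltr01 divr_gt0.
exists C1, 1, C3, C4, C5, eps0; split => //.
move=> A eps cA AM dH eps_le z Az.
have [A0 near] := hausdorff_proj M0 cA dH.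
have [x0 Mx0] := M0.
have e0 : 0 <= eps by case: (near x0 Mx0) => y _; apply: le_trans (enorm_ge0 _).
have := he0 eps; rewrite e0 eps_le => /(_ isT) /=.
move=> /and5P[epsC3 epsC4 epsC1 eps1 /andP[epstheta _]].
have {}epsC1 : C1 * eps ^+ 2 < sig / 4.
  apply: le_lt_trans epsC1; rewrite mulrC ler_wpM2r ?(ltW C10)//.
  by rewrite expr2 ler_piMl// -[eps]mulr1 ltW.
have mu_ok : 0 <= C3 * eps < mu0.
  by rewrite mulr_ge0 ?(ltW C30)// mulrC.
have [x px] := proj_set_neq0 M0 cM z; have [Mx _] := px.
have dE := proj_set_dist px.
have dL : dist M z <= L.
  by rewrite dE; exact: crit_in_diameter AM diam Az Mx.
have sqA : dist A z ^+ 2 <= dist M z ^+ 2 + B * eps ^+ 2.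
  rewrite dE; apply: le_trans (sqr_dist_sample K0 quad A0 cA AM near px) _.
  rewrite lerD2l ler_wpM2r ?sqr_ge0// lerD2l -dE.
  by rewrite ler_wpM2l ?mulr_ge0 ?(ltW K0).
rewrite /= mul1r.
(* The slack tau is there because the distance to the mu-critical set may not be attained. *)
have b_near (tau : R) :
    (set_dist (mu_crit (C3 * eps) M) z <= eps%:E)%E -> 0 < tau ->
    exists2 z', crit M z' & enorm (z - z') <= C4 * eps + tau.
  move=> hb tau0.
  have [|y ymu zy] := @set_dist_lt (mu_crit (C3 * eps) M) z (eps + tau).
    by apply: le_lt_trans hb _; rewrite lte_fin ltrDl.
  have [z' Zz' yz'] := hP4 _ _ mu_ok ymu.
  exists z' => //; apply: le_trans (enorm_dist3 y _ _) _.
  by rewrite /C4 mulrDl mul1r -mulrA; lra.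
split.
- have [dle|dgt] := leP (4 * K * dist M z) 1.
    left; rewrite (set_dist_fin M0 cM) lee_fin dE.
    rewrite dE in sqA dle.
    exact: (crit_near_submanifold K0 quad A0 cA AM Az px sqA (ltW B0) dle).
  right.
  (* For eps = 0 the ball used in [crit_far_submanifold] degenerates, but then A = M and z is itself
     critical for M. *)
  have [eps_eq0|eps_n0] := eqVneq eps 0.
    have AE : A = M.
      apply/seteqP; split => // y My; have [y' Ay' yy'] := near y My.
      have /enorm_eq0/eqP : enorm (y - y') = 0.
        by apply/eqP; rewrite eq_le enorm_ge0 -eps_eq0 yy'.
      by rewrite subr_eq0 => /eqP ->.
    rewrite AE in Az; have [nMz gz] := Az.
    apply: le_trans (set_dist_le (y := z) _ _) _.
      by split=> //; rewrite gz enorm0 mulr_ge0 ?(ltW C30).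
    by rewrite subrr enorm0 lee_fin.
  have ep : 0 < eps by rewrite lt_neqAle eq_sym eps_n0.
  have d0 : 0 < dist M z.
    have k0 : 0 < 4 * K by rewrite mulr_gt0.
    by rewrite -(pmulr_rgt0 _ k0) (lt_trans ltr01 dgt).
  have [|y ymu zy] :=
    crit_far_submanifold M0 cM A0 cA AM Az sqA ep (mulr_ge0 (ltW C30) e0) d0.
    have : (B + 1) * eps * 1 < (B + 1) * eps * (4 * K * dist M z).
      by rewrite ltr_pM2l// mulr_gt0// addr_gt0.
    have : 0 < (B + 1) * eps by rewrite mulr_gt0// addr_gt0.
    by rewrite /C3; lra.
  by apply: le_trans (set_dist_le _ ymu) _; rewrite lee_fin.
- move=> [ha hb].
  (* Both cases together would put the critical point z' of M within 3/4 of [sig] of M. *)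
  have [|z' Zz' zz'] := b_near (sig / 4) hb; first by rewrite divr_gt0.
  have := away z' Zz'; have := dist_triangle M0 cM z' z; rewrite enormC.
  move: ha; rewrite (set_dist_fin M0 cM) lee_fin mulrC in epsC4 *.
  by move=> ha; lra.
- move=> hb.
  have finZc := finite_compact finZ.
  have Z0 : crit M !=set0 by have [z' Zz' _] := b_near 1 hb ltr01; exists z'.
  have [z' pz'] := proj_set_neq0 Z0 finZc z; have [Zz' _] := pz'.
  (* The nearest critical point beats the one found for each tau, which removes the slack. *)
  have zz' : enorm (z - z') <= C4 * eps.
    apply/ler_addgt0Pr => tau tau0; have [z'' Zz'' h] := b_near tau hb tau0.
    rewrite -(proj_set_dist pz'); apply: le_trans h; exact: dist_le.
  split; first by apply: le_trans (set_dist_le _ Zz') _; rewrite lee_fin.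
  exists z'; split => // y py; have [Ay _] := py; have My := AM _ Ay.
  have dAM : dist A z <= dist M z + eps.
    have [x' Ax' xx'] := near x Mx; rewrite dE.
    apply: le_trans (dist_le A0 cA z Ax') _.
    by apply: le_trans (enorm_dist3 x _ _) _; rewrite lerD2l.
  have [|q pq yq] := nearp z' y Zz' My.
    have := dist_triangle M0 cM z z'; have := enorm_dist3 z z' y.
    rewrite (enormC z' z) -(proj_set_dist py).
    by rewrite mulrDr mulr1 in epstheta; lra.
  apply: le_trans (set_dist_le _ pq) _; rewrite lee_fin.
  have gr := growth z' q y Zz' pq My yq.
  rewrite (proj_set_dist py) in sqA.
  exact: (proj_near_crit s0 (ltW B0) (ltW C40) e0 M0 cM pq gr sqA zz').
Qed.

End SubsetStability.

(** * Counting *)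

Section Counting.

Lemma card_le_inj (T U : Type) (A : set T) (B : set U) (f : T -> U) :
  (forall x, A x -> B (f x)) ->
  (forall x y, A x -> A y -> f x = f y -> x = y) -> A #<= B.
Proof.
move=> AB injf.
have fA : {in A &, injective f} by move=> x y /set_mem Ax /set_mem Ay; exact: injf.
have /card_eqPle[_ le] := inj_card_eq fA.
by apply: card_le_trans le _; apply: subset_card_le => _ [x Ax <-]; exact: AB.
Qed.

Lemma card_le_fin (T : Type) (F : finType) (A : set T) (f : T -> F) :
  (forall x y, A x -> A y -> f x = f y -> x = y) -> A #<= `I_#|F|.
Proof.
move=> injf; apply: (@card_le_inj _ _ _ _ (fun x => enum_rank (f x) : nat)).
  by move=> x _; exact: ltn_ord.
by move=> x y Ax Ay /val_inj/enum_rank_inj; exact: injf.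
Qed.

Lemma card_le_II_inj (T : Type) (A : set T) n : A #<= `I_n ->
  exists f : T -> nat, (forall x, A x -> (f x < n)%N) /\
    forall x y, A x -> A y -> f x = f y -> x = y.
Proof.
move=> /pcard_leP[f]; exists f; split=> [x Ax|x y Ax Ay].
  exact: (@funS _ _ _ _ f x Ax).
by apply: inj; exact: mem_set.
Qed.

(** Each w is recovered from the characteristic function of [F w], read on numerical codes below n
    for the elements of P. *)
Lemma card_le_subsets (T T' : Type) (P : set T) (W : set T') (F : T' -> set T) n :
    P #<= `I_n -> (forall w, W w -> F w `<=` P) ->
    (forall w w', W w -> W w' -> F w = F w' -> w = w') ->
  W #<= `I_(2 ^ n).
Proof.
move=> /card_le_II_inj[f [fn finj]] WP Finj.
have := @card_le_fin T' {ffun 'I_n -> bool} W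
  (fun w => [ffun i : 'I_n => `[< exists2 a, F w a & f a = i >]]).
rewrite card_ffun card_bool card_ord; apply => w w' Ww Ww' /ffunP e.
apply: Finj => //.
have sub v v' : W v -> W v' -> (forall i : 'I_n,
      `[< exists2 a, F v a & f a = i >] -> `[< exists2 a, F v' a & f a = i >]) ->
    F v `<=` F v'.
  move=> Wv Wv' h a Fa; have Pa := WP _ Wv _ Fa.
  have /h/asboolP[a' Fa' faa'] :
      `[< exists2 a0, F v a0 & f a0 = Ordinal (fn a Pa) >].
    by apply/asboolP; exists a.
  by rewrite -(finj _ _ (WP _ Wv' _ Fa') Pa faa').
apply/seteqP; split; apply: sub => // i; have := e i; rewrite !ffunE => ->//.
Qed.

Lemma card_le_bigcup (T T' : Type) (S : set T') (P : T' -> set T) s n :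
    S #<= `I_s -> (forall p, S p -> P p #<= `I_n) ->
  \bigcup_(p in S) P p #<= `I_(n * s).
Proof.
move=> /card_le_II_inj[g [gs ginj]] hP.
have [S0|noS] := pselect (S !=set0); last first.
  apply: (@card_le_inj _ _ _ _ (fun=> 0%N)) => [x|x y] [p Sp];
  by case: noS; exists p.
have [p0 _] := S0.
have he p : exists e : T -> nat, S p -> (forall x, P p x -> (e x < n)%N) /\
    forall x y, P p x -> P p y -> e x = e y -> x = y.
  have [Sp|nSp] := pselect (S p); last by exists (fun=> 0%N).
  by have [e ?] := card_le_II_inj (hP p Sp); exists e.
pose e p := sval (cid (he p)); have eP p := svalP (cid (he p)).
have hq x : exists p, (\bigcup_(p in S) P p) x -> S p /\ P p x.
  have [[p Sp Px]|no] := pselect ((\bigcup_(p in S) P p) x); first by exists p.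
  by exists p0.
pose q x := sval (cid (hq x)); have qP x := svalP (cid (hq x)).
(* The pair formed by the index of a piece and the position in it, written in base n; quotient and
   remainder recover it. *)
apply: (@card_le_inj _ _ _ _ (fun x => g (q x) * n + e (q x) x)%N).
  move=> x /qP[Sq Pq] /=; have lt := (eP _ Sq).1 _ Pq.
  apply: (@leq_trans ((g (q x)).+1 * n)); first by rewrite mulSnr ltn_add2l.
  by rewrite mulnC leq_mul2l gs ?orbT.
move=> x y /qP[Sq Pq] /qP[Sq' Pq'] eq.
have lt := (eP _ Sq).1 _ Pq; have lt' := (eP _ Sq').1 _ Pq'.
have n0 : (0 < n)%N by exact: leq_ltn_trans lt.
have qq : q x = q y.
  apply: ginj => //; have := congr1 (divn^~ n) eq.
  by rewrite !divnMDl// !divn_small// !addn0.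
have := congr1 (modn^~ n) eq; rewrite !modnMDl !modn_small//.
rewrite -/(q x) -/(q y) in Pq Pq' *.
by rewrite -qq in Pq' *; exact: (eP _ Sq).2.
Qed.

End Counting.

(** * Packing numbers *)

Section Packing.
Context {R : realType} {D : nat}.
Implicit Types (x y z : 'rV[R]_D) (A M : set 'rV[R]_D).

Lemma coords_nth m (q : seq 'rV[R]_D) v : size q = m ->
  coords q v = \sum_(i < m) dot v q`_i ^+ 2.
Proof. by move=> <-; rewrite /coords (big_nth 0) big_mkord. Qed.

(* Points are told apart by the cubes of side delta / (4 m) that contain their
   coordinates in the approximate tangent space. *)
Lemma packing_cards_le m M (r0 delta rho : R) n : (1 <= m)%N ->
    (forall x, M x -> almost_flat m M r0 x) -> 0 < delta -> delta <= rho ->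
    rho <= r0 -> packing_cards M delta rho n ->
  n%:R <= ((8 * m%:R + 1) * rho / delta) ^+ m.
Proof.
move=> m1 flat d0 drho rhor [x [A [Mx [_ AM _ sepA] An]]].
have [q [sq qle qge]] := flat x Mx.
have mp : 0 < m%:R :> R by rewrite ltr0n.
have rho0 : 0 < rho := lt_le_trans d0 drho.
(* Two points in one cube have [coords] of their difference at most m sd^2; four times this is
   delta^2 / (4 m), less than the delta^2 required by separation and flatness. *)
pose sd := delta / (4 * m%:R).
have sd0 : 0 < sd by rewrite divr_gt0// mulr_gt0.
(* Adding rho makes the coordinate nonnegative, so [c] lies between 0 and 2 rho / sd and its
   truncation takes at most k + 1 values. *)
pose c y i := (dot (y - x) q`_i + rho) / sd.
pose k := Num.trunc (8 * m%:R * rho / delta).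
have cB y (i : 'I_m) : A y -> 0 <= c y i <= 8 * m%:R * rho / delta.
  move=> /AM[hy _]; have h : `|dot (y - x) q`_i| <= rho.
    rewrite -ler_sqr ?nnegrE ?(ltW rho0)// real_normK ?num_real//.
    apply: (@le_trans _ _ (coords q (y - x))).
      rewrite (coords_nth _ sq) (bigD1 i)//= lerDl.
      by apply: sumr_ge0 => j _; exact: sqr_ge0.
    apply: le_trans (qle _) _; rewrite -enorm_ler_sqr ?(ltW rho0)// enormC.
    exact: ltW.
  move: h; rewrite ler_norml => /andP[h1 h2].
  rewrite divr_ge0 ?(ltW sd0)//=; last by lra.
  rewrite (_ : 8 * m%:R * rho / delta = (rho + rho) / sd).
    by rewrite ler_pM2r ?invr_gt0// lerD2r.
  by rewrite /sd; field; rewrite !gt_eqF.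
have codes : A #<= `I_(k.+1 ^ m).
  have := @card_le_fin _ {ffun 'I_m -> 'I_k.+1} A
    (fun y => [ffun i : 'I_m => inord (Num.trunc (c y i))]).
  rewrite card_ffun !card_ord; apply => y y' Ay Ay' /ffunP e.
  apply: contrapT => yy'.
  have close i : (dot (y' - y) q`_(i : 'I_m)) ^+ 2 <= sd ^+ 2.
    have /andP[c0 cle] := cB y i Ay; have /andP[c0' cle'] := cB y' i Ay'.
    have := e i; rewrite !ffunE => /(congr1 (@nat_of_ord _)).
    rewrite !inordK ?ltnS ?le_truncn// => tt.
    have /andP[t1 t2] := truncn_itv c0; have /andP[t1' t2'] := truncn_itv c0'.
    rewrite -tt in t1' t2'; move: t1 t2 t1' t2'; rewrite -natr1.
    set t := (_%:R) => t1 t2 t1' t2'.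
    have cE u : dot (u - x) q`_i = c u i * sd - rho.
      by rewrite /c divfK ?gt_eqF// addrK.
    have -> : dot (y' - y) q`_i = (c y' i - c y i) * sd.
      rewrite (_ : y' - y = (y' - x) - (y - x)); last by rewrite opprB subrKA.
      by rewrite [LHS]dotBl !cE; ring.
    rewrite exprMn ler_piMl ?sqr_ge0// -(expr1n _ 2) -real_normK ?num_real//.
    by rewrite ler_sqr ?nnegrE// ler_norml; lra.
  have hd : delta ^+ 2 <= dot (y' - y) (y' - y).
    by rewrite -enorm_ger_sqr ?(ltW d0)// enormC; exact: sepA.
  have inr u : A u -> M u /\ eball x r0 u.
    by move=> /AM[hu Mu]; split=> //; exact: lt_le_trans hu rhor.
  have [My hy] := inr _ Ay; have [My' hy'] := inr _ Ay'.
  have := le_trans hd (qge _ _ My My' hy hy').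
  rewrite (coords_nth _ sq) leNgt => /negP; apply.
  apply: (@le_lt_trans _ _ (4 * (m%:R * sd ^+ 2))).
    rewrite ler_wpM2l// mulr_natl -[X in _ *+ X]card_ord -sumr_const.
    by apply: ler_sum => i _; exact: close.
  rewrite (_ : 4 * (m%:R * sd ^+ 2) = delta ^+ 2 / (4 * m%:R)); last first.
    by rewrite /sd; field; rewrite gt_eqF.
  rewrite ltr_pdivrMr ?mulr_gt0// ltr_pMr ?exprn_gt0//.
  have : 1 <= m%:R :> R by rewrite ler1n.
  by lra.
have nk : (n <= k.+1 ^ m)%N.
  by move: An => /card_eqPle[_ nA]; rewrite -card_le_II (card_le_trans nA).
apply: (@le_trans _ _ (k.+1 ^ m)%:R); first by rewrite ler_nat.
rewrite natrX lerXn2r ?nnegrE ?ler0n//.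
  by rewrite divr_ge0 ?(ltW d0)// mulr_ge0 ?(ltW rho0)// addr_ge0// mulr_ge0.
(* The extra 1 in k + 1 is at most rho / delta. *)
rewrite mulrDl mul1r mulrDl -natr1 lerD//; last by rewrite ler_pdivlMr// mul1r.
rewrite truncn_le divr_ge0 ?(ltW d0)// mulr_ge0 ?(ltW rho0)// mulr_ge0//.
Qed.

(** The empty packing and the bound b make the maximum exist, so [xget] does not return its
    default. *)
Lemma packing_numberP M (delta rho b : R) : M !=set0 ->
    (forall n, packing_cards M delta rho n -> n%:R <= b) ->
  packing_cards M delta rho (packing_number M delta rho) /\
  forall k, packing_cards M delta rho k -> (k <= packing_number M delta rho)%N.
Proof.
move=> [x0 Mx0] hb.
have c0 : exists n, `[< packing_cards M delta rho n >].
  exists 0%N; apply/asboolP; exists x0, set0; split=> //.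
    by split => //; rewrite leey.
  by rewrite II0 card_eq00.
have cb n : `[< packing_cards M delta rho n >] -> (n <= Num.trunc b)%N.
  move=> /asboolP/hb nb; rewrite truncn_ge_nat//; exact: le_trans nb.
case: (ex_maxnP c0 cb) => N /asboolP cN maxN.
rewrite /packing_number; case: xgetP => [n _ //|/(_ N)[]]; split => // k ck.
by apply: maxN; apply/asboolP.
Qed.

End Packing.

(** * Counting the critical points of a sampling *)

Lemma subset_stability_mono (R : realType) (D : nat) (M : set 'rV[R]_D)
    (C1 C2 C3 C4 C5 C5' eps0 : R) : M !=set0 -> C5 <= C5' ->
  subset_stability M C1 C2 C3 C4 C5 eps0 ->
  subset_stability M C1 C2 C3 C4 C5' eps0.
Proof.
move=> M0 le stab A eps cA AM dH eps_le z Az.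
have [ab nab hb] := stab A eps cA AM dH eps_le z Az.
have [x0 Mx0] := M0; have [_ near] := hausdorff_proj M0 cA dH.
have e0 : 0 <= eps by case: (near x0 Mx0) => y _; apply: le_trans (enorm_ge0 _).
split=> // /hb[dz [z' [Zz' zz' h]]]; split=> //; exists z'; split=> // y /h hy.
by apply: le_trans hy _; rewrite lee_fin ler_wpM2r.
Qed.

Theorem corollary1p7 (R : realType) (m : nat) (m_ge1 : (1 <= m)%N) :
  exists Cm : R, 0 < Cm /\
  forall (D : nat) (M : set 'rV[R]_D),
    (2 <= D)%N -> M !=set0 -> compact M -> C2_submanifold m M ->
    condP1 M -> condP2 M -> condP3 M -> condP4 M ->
    exists C1 C2 C3 C4 C5 eps0 eps1 : R,
      [/\ [/\ 0 < C1, 0 < C2, 0 < C3, 0 < C4 & 0 < C5],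
          0 < eps0, 0 < eps1,
          subset_stability M C1 C2 C3 C4 C5 eps0 &
          forall delta eps : R, 0 < delta -> delta <= eps -> eps <= eps1 ->
            (forall (A : set 'rV[R]_D), sampling delta eps%:E M A ->
              forall (z : 'rV[R]_D) (s : nat),
                crit M z -> proj_set M z #= `I_s ->
                [set w | crit A w /\ enorm (w - z) < C4 * eps]
                  #<= `I_(2 ^ (packing_number M delta (C5 * eps) * s)))
            /\ (packing_number M delta (C5 * eps))%:R
                 <= (Cm * C5 * eps / delta) ^+ m].
Proof.
(* The constant of the cube count in [packing_cards_le]. *)
exists (8 * m%:R + 1); split; first by rewrite ltr_wpDl// mulr_ge0.
move=> D M _ M0 cM C2M P1 P2 P3 P4.
have [C1 [C2 [C3 [C4 [c5 [eps0 [[C10 C20 C30 C40 c50] eps00 stab]]]]]]] :=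
  subset_stability_exists M0 cM C2M P1 P2 P3 P4.
have [r0 r00 flat] := submanifold_almost_flat cM C2M.
have [sep sep0 hsep] := finite_separated P2.
have [sig sig0 away] := crit_away M0 cM P2.
(* Stability gives distances at most c5 eps, whereas packings live in open balls; the larger C5
   makes the inequality strict. *)
pose C5 := c5 + 1.
have C50 : 0 < C5 by rewrite addr_gt0.
have [|eps1 eps10 heps1] := @exists_small_scale R
  (* In order: stability applies; eps^2 <= eps; M is almost flat at scale C5 eps; two critical
     points of M cannot both be within C4 eps of w; case (a) is excluded near z. *)
  [:: (1, eps0); (1, 1); (C5, r0); (2 * C4, sep); (C4 + C1, sig)].
  by rewrite /= eps00 ltr01 r00 sep0 sig0.
exists C1, C2, C3, C4, C5, eps0, eps1; split => //.
  by apply: subset_stability_mono stab => //; rewrite lerDl.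
move=> delta eps delta0 deps eps_le.
have ep : 0 < eps := lt_le_trans delta0 deps.
have := heps1 eps; rewrite ltW// eps_le => /(_ isT) /=; rewrite mulr1.
move=> /and5P[/ltW epseps0 eps_lt1 /ltW epsC5 epssep /andP[epssig _]].
have pack n : packing_cards M delta (C5 * eps) n ->
    n%:R <= ((8 * m%:R + 1) * (C5 * eps) / delta) ^+ m.
  apply: (packing_cards_le m_ge1 flat) => //; last by rewrite mulrC.
  by apply: le_trans deps _; rewrite ler_peMl ?(ltW ep)// lerDr ltW.
have [packN maxN] := packing_numberP M0 pack.
split; last by rewrite -(mulrA _ C5); exact: pack.
move=> A [finA AM dA sepA] z s Zz pis.
have cA := finite_compact finA.
have [A0 _] := hausdorff_proj M0 cA dA.
have near w y : crit A w -> enorm (w - z) < C4 * eps -> proj_set A w y ->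
    exists2 p, proj_set M z p & enorm (y - p) < C5 * eps.
  move=> Aw wz py; have [ab _ hb] := stab A eps cA AM dA epseps0 w Aw.
  have /hb[_ [z' [Zz' wz' h]]] :
      (set_dist (mu_crit (C3 * eps) M) w <= (C2 * eps)%:E)%E.
    case: ab => // ha; exfalso; move: ha; rewrite (set_dist_fin M0 cM) lee_fin.
    have := away z Zz; have := dist_triangle M0 cM z w; rewrite enormC.
    have : C1 * eps ^+ 2 <= C1 * eps.
      by rewrite ler_wpM2l ?(ltW C10)// expr2 ler_piMl// ltW.
    by rewrite mulrDr in epssig; lra.
  (* Stability provides some critical point z' close to w; separation of the critical set identifies
     it with the given z. *)
  have z'z : z' = z.
    apply: contrapT => /(hsep z z' Zz Zz').
    have := enorm_dist3 w z z'; rewrite (enormC z w).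
    by lra.
  rewrite z'z in h; have hy := h y py.
  by apply: set_dist_lt; apply: le_lt_trans hy _; rewrite lte_fin ltr_pM2r// ltrDl.
pose P := \bigcup_(p in proj_set M z) (A `&` eball p (C5 * eps)).
apply: (@card_le_subsets _ _ P _ (proj_set A)).
- have /card_eqPle[pis_le _] := pis.
  apply: card_le_bigcup pis_le _ => p [Mp _].
  have fin : finite_set (A `&` eball p (C5 * eps)) by exact: finite_setIl.
  have [k kE] := (finite_setP _).1 fin.
  (* The part of A in the ball is itself a packing around the point p of M, so its cardinality is at
     most the packing number. *)
  have /maxN kN : packing_cards M delta (C5 * eps) k.
    exists p, (A `&` eball p (C5 * eps)); split => //; split => //.
    + by move=> y [Ay hy]; split=> //; exact: AM.
    + by rewrite leey.
    + by move=> x y [Ax _] [Ay _]; exact: sepA.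
  by have /card_eqPle[le _] := kE; apply: card_le_trans le _; rewrite card_le_II.
- move=> w [Aw wz] y py; have [p pp yp] := near w y Aw wz py.
  by exists p => //; split; [case: py | rewrite /eball/= enormC].
- move=> w w' [Aw _] [Aw' _] e.
  by rewrite (crit_seb_center A0 cA Aw) e -(crit_seb_center A0 cA Aw').
Qed.
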